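(* Let $\Bbbk$ be a field of characteristic zero and let $\sim$ be a word relation that is homogeneous and uniformly algebraic. Then the following are equivalent: (i) the image of $\mathbf K^{(\sim)}$ under $\psi_{\le}$ is a sub-bialgebra of $\mathsf{Sym}$; (ii) the image of $\mathbf K^{(\sim)}$ under $\psi_{>}$ is a sub-bialgebra of $\mathsf{Sym}$; (iii) $\sim$ extends Knuth equivalence.
   Context: Words. $[n]=\{1,\dots,n\}$; $\mathbb P$ is the set of positive integers. A word is a finite sequence of positive integers; $\ell(w)$ is its length, $\max(w)$ its largest letter, $\max(\emptyset)=0$. $w\cap S$ is the subword formed by omitting letters not in $S$. Word relations. A word relation is an equivalence relation on words such that $v\sim w$ only if $v,w$ have the same set of letters (multiplicities may differ). It is homogeneous if $v\sim w$ implies $\ell(v)=\ell(w)$. It is uniformly algebraic if for all words $v,w$: (a) $v\sim v'$, $w\sim w'$ imply $vw\sim v'w'$; (b) if $v\sim w$ and $I\subset\mathbb P$ is a set of consecutive integers then $v\cap I\sim w\cap I$; (c) if $v\sim w$ then $\phi(v)\sim\phi(w)$ for any order-preserving injection $\phi:[\min(v),\max(v)]\to\mathbb P$ (integer interval; applied letterwise). A relation $\sim$ extends $\approx$ if $v\approx w$ implies $v\sim w$. Knuth equivalence is the smallest equivalence relation on words which is a congruence for concatenation and satisfies $bac\sim bca$, $acb\sim cab$, $aba\sim baa$, $bab\sim bba$ for all positive integers $a<b<c$. Spaces. $\mathbf W$ is the $\Bbbk$-vector space with basis all pairs $[w,n]$, $n\in\mathbb N=\{0,1,2,\dots\}$,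 $w$ a word with $\max(w)\le n$. For a $\sim$-equivalence class $E$ of words with letters in $[n]$ let $\kappa_E^n=\sum_{w\in E}[w,n]$ (finite as $\sim$ is homogeneous); $\mathbf K^{(\sim)}\subset\mathbf W$ is the span of all $\kappa_E^n$, over all $n\in\mathbb N$ and all $E$. Quasi-symmetric functions. A composition $\alpha=(\alpha_1,\dots,\alpha_l)\vDash n$ is a sequence of positive integers with sum $n$, and $I(\alpha)=\{\alpha_1,\alpha_1+\alpha_2,\dots,\alpha_1+\cdots+\alpha_{l-1}\}\subset[n-1]$. $M_\alpha=\sum_{i_1<\cdots<i_l}x_{i_1}^{\alpha_1}\cdots x_{i_l}^{\alpha_l}$ ($M_\emptyset=1$), and $L_\alpha=\sum_{\beta\vDash n,\,I(\alpha)\subseteq I(\beta)}M_\beta$. $\mathsf{QSym}$ is the Hopf algebra with basis $\{M_\alpha\}$, the product of power series, coproduct $\Delta(M_\alpha)=\sum_{\alpha=\beta\gamma}M_\beta\otimes M_\gamma$ (over concatenations), and counit $\epsilon(M_\alpha)=1$ if $\alpha=\emptyset$ and $0$ otherwise; $\mathsf{Sym}\subset\mathsf{QSym}$ is the Hopf subalgebra of symmetric functions. The maps. $\psi_{\le},\psi_{>}:\mathbf W\to\mathsf{QSym}$ are the linear maps with $\psi_{\le}([w,n])=L_\alpha$ and $\psi_{>}([w,n])=L_{\alpha^{\mathsf c}}$, where $\alpha\vDash\ell(w)$ has $I(\alpha)=\mathrm{Des}(w)=\{i\in[\ell(w)-1]:w_i>w_{i+1}\}$ and $\alpha^{\mathsf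 c}\vDash\ell(w)$ has $I(\alpha^{\mathsf c})=[\ell(w)-1]\setminus I(\alpha)$. (Equivalently, they are the canonical morphisms of combinatorial bialgebras to $\mathsf{QSym}$ associated to the characters $\mathbf W\to\Bbbk[t]$ sending $[w,n]\mapsto t^{\ell(w)}$ if $w$ is weakly increasing, respectively strictly decreasing, and to $0$ otherwise.) *)

(* Defs.v *)
From HB Require Import structures.
From mathcomp Require Import all_boot all_order all_algebra finmap.
From mathcomp.multinomials Require Import monalg.
From mathcomp Require Import zify.
From mathcomp Require Import boolp classical_sets cardinality fsbigop.

Set Implicit Arguments.
Unset Strict Implicit.
Unset Printing Implicit Defensive.

Import GRing.Theory.

Local Open Scope classical_set_scope.
Local Open Scope ring_scope.

Record posint := PosInt { posint_val :> nat; _ : (0 < posint_val)%N }.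
HB.instance Definition _ := [isSub for posint_val].
HB.instance Definition _ := [Choice of posint by <:].

Notation word := (seq posint).

Definition maxw (w : word) : nat := \max_(a <- w) (a : nat).

(* [min v, max v] as a set of positive integers; empty for the empty word. *)
Definition hull (v : word) : pred posint :=
  [pred a : posint | has (fun x : posint => (x <= a)%N) v
                  && has (fun y : posint => (a <= y)%N) v].

(* Convex sets of positive integers: intervals, bounded or not, possibly
   empty. *)
Definition consecutive (I : pred posint) :=
  forall a b c : posint, I a -> I c -> (a <= b <= c)%N -> I b.

Record word_relation (sim : word -> word -> Prop) : Prop := WordRelation {
  wrel_refl : forall v, sim v v;
  wrel_sym : forall v w, sim v w -> sim w v;
  wrel_trans : forall u v w, sim u v -> sim v w -> sim u w;
  wrel_letters : forall v w, sim v w -> v =i w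
}.

Definition homogeneous (sim : word -> word -> Prop) :=
  forall v w, sim v w -> size v = size w.

(* In the last clause [phi] is given on all positive integers, but only its
   restriction to [min v, max v] is constrained or used. *)
Record uniformly_algebraic (sim : word -> word -> Prop) : Prop :=
  UniformlyAlgebraic {
  ualg_cat : forall v v' w w',
    sim v v' -> sim w w' -> sim (v ++ w) (v' ++ w');
  ualg_restrict : forall v w (I : pred posint), consecutive I ->
    sim v w -> sim (filter I v) (filter I w);
  ualg_map : forall v w (phi : posint -> posint),
    {in hull v &, injective phi} ->
    {in hull v &, {homo phi : x y / (x <= y)%N}} ->
    sim v w -> sim (map phi v) (map phi w)
}.

Definition extends (sim app : word -> word -> Prop) :=
  forall v w, app v w -> sim v w.

Inductive knuth : word -> word -> Prop :=
| knuth_refl v : knuth v v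
| knuth_sym v w : knuth v w -> knuth w v
| knuth_trans u v w : knuth u v -> knuth v w -> knuth u w
| knuth_cat v v' w w' : knuth v v' -> knuth w w' -> knuth (v ++ w) (v' ++ w')
| knuth_bac (a b c : posint) : (a < b < c)%N ->
    knuth [:: b; a; c] [:: b; c; a]
| knuth_acb (a b c : posint) : (a < b < c)%N ->
    knuth [:: a; c; b] [:: c; a; b]
| knuth_aba (a b : posint) : (a < b)%N -> knuth [:: a; b; a] [:: b; a; a]
| knuth_bab (a b : posint) : (a < b)%N -> knuth [:: b; a; b] [:: b; b; a].

Section Linear.
Variable k : fieldType.

Definition span (V : lmodType k) (S : set V) : set V :=
  [set x | exists (n : nat) (c : 'I_n -> k) (v : 'I_n -> V),
    (forall i, S (v i)) /\ x = \sum_(i < n) c i *: v i].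

Definition linext (B : choiceType) (V : lmodType k) (f : B -> V)
    (x : {malg k[B]}) : V :=
  \sum_(b <- msupp x) x@_b *: f b.

(* {malg k[(B * C)%type]} serves as the tensor product of {malg k[B]} and
   {malg k[C]}, with << (b, c) >> standing for b (x) c. *)
Definition tensor (B C : choiceType) (x : {malg k[B]}) (y : {malg k[C]}) :
    {malg k[(B * C)%type]} :=
  \sum_(b <- msupp x) \sum_(c <- msupp y) (x@_b * y@_c) *: << (b, c) >>.

End Linear.

Record wpair := WPair {
  wpair_val : word * nat;
  _ : (maxw wpair_val.1 <= wpair_val.2)%N
}.
HB.instance Definition _ := [isSub for wpair_val].
HB.instance Definition _ := [Choice of wpair by <:].

Definition wp_word (b : wpair) : word := (wpair_val b).1.
Definition wp_n (b : wpair) : nat := (wpair_val b).2.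

Section K.
Variable k : fieldType.

Definition is_class (sim : word -> word -> Prop) (n : nat) (E : set word) :=
  exists2 u : word, (maxw u <= n)%N & E = [set v | sim u v].

Definition kappa (n : nat) (E : set word) : {malg k[wpair]} :=
  \sum_(b \in [set b | wp_n b = n /\ E (wp_word b)])
    (<< b >> : {malg k[wpair]}).

Definition Kspace (sim : word -> word -> Prop) : set {malg k[wpair]} :=
  span [set x | exists n E, is_class sim n E /\ x = kappa n E].

End K.

Notation compn := (seq posint).

Definition weight (a : compn) : nat := \sum_(x <- a) (x : nat).

Definition cset (a : compn) : set nat :=
  [set i | exists2 j : nat, (0 < j < size a)%N & i = weight (take j a)].

(* Well defined for S a subset of [n-1], by [comp_ofP] and [cset_inj]. *)
Definition comp_of (n : nat) (S : set nat) : compn :=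
  xget [::] [set a : compn | weight a = n /\ cset a = S].

Lemma weight_rcons a x : weight (rcons a x) = (weight a + x)%N.
Proof. by rewrite /weight -cats1 big_cat big_seq1. Qed.

Lemma weight_gt0 a : (0 < size a)%N -> (0 < weight a)%N.
Proof.
case: a => [//|[x x0] a] _; rewrite /weight big_cons /=.
exact: ltn_addr.
Qed.

Lemma cset_rcons a x i :
  cset (rcons a x) i <-> cset a i \/ (0 < size a)%N /\ i = weight a.
Proof.
split=> [[j] | [[j] | []]].
- rewrite size_rcons ltnS => /andP[j0 ja] ->.
  move: ja; rewrite leq_eqVlt => /orP[/eqP ja|ja].
    by right; split; [rewrite -ja | rewrite ja -cats1 take_size_cat].
  left; exists j; first by rewrite j0.
  by rewrite -cats1 takel_cat // ltnW.
- move=> /andP[j0 ja] ->; exists j; last by rewrite -cats1 takel_cat // ltnW.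
  by rewrite j0 size_rcons ltnW.
move=> a0 ->; exists (size a); first by rewrite a0 size_rcons /=.
by rewrite -cats1 take_size_cat.
Qed.

Lemma cset_bound a i : cset a i -> (0 < i < weight a)%N.
Proof.
elim/last_ind: a i => [|a x IH] i; first by case=> j; rewrite andbF.
have x0 : (0 < x)%N by case: x.
rewrite weight_rcons => /cset_rcons[/IH /andP[-> /=]|[a0 ->]].
  by move=> lti; exact: ltn_addr.
by rewrite weight_gt0 //= -[X in (X < _)%N]addn0 ltn_add2l.
Qed.

Lemma cset_inj a b : weight a = weight b -> cset a = cset b -> a = b.
Proof.
have le0 (c d : compn) x y : cset (rcons c x) `<=` cset (rcons d y) ->
    (weight c <= weight d)%N.
  move=> sub; case: (posnP (size c)) => [/size0nil ->|c0].
    by rewrite /weight big_nil.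
  have /sub/cset_rcons[/cset_bound /andP[_ /ltnW] //|[_ <-//]] :
    cset (rcons c x) (weight c) by apply/cset_rcons; right.
elim/last_ind: a b => [|a x IH] b.
  case: b => // y b; rewrite {1}/weight big_nil => /esym w0.
  by have := @weight_gt0 (y :: b) isT; rewrite w0.
case/lastP: b => [|b y].
  rewrite {2}/weight big_nil => w0.
  by have := @weight_gt0 (rcons a x); rewrite w0 size_rcons => /(_ isT).
move=> ew ec.
have eab : weight a = weight b.
  by apply/eqP; rewrite eqn_leq (le0 a b x y) ?(le0 b a y x) ?ec.
have exy : x = y.
  apply: val_inj; move: ew; rewrite !weight_rcons eab => /eqP.
  by rewrite eqn_add2l => /eqP.
rewrite exy (IH b eab) //; apply/seteqP; split=> i ci.
  have /cset_rcons[//|[_ ib]] : cset (rcons b y) i.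
    by rewrite -ec; apply/cset_rcons; left.
  by have := cset_bound ci; rewrite ib eab ltnn andbF.
have /cset_rcons[//|[_ ib]] : cset (rcons a x) i.
  by rewrite ec; apply/cset_rcons; left.
by have := cset_bound ci; rewrite ib eab ltnn andbF.
Qed.

Lemma comp_ofP n S : S `<=` [set i | (0 < i < n)%N] ->
  weight (comp_of n S) = n /\ cset (comp_of n S) = S.
Proof.
move=> sub; rewrite /comp_of.
apply: (@xgetPex _ [::] [set a : compn | weight a = n /\ cset a = S]).
have [m] := ubnP n; elim: m n S sub => // m IH n S sub.
rewrite ltnS => lenm.
have [n0|n0] := posnP n.
  move: sub; rewrite n0 => sub; exists [::]; split; first by rewrite /weight big_nil.
  by apply/seteqP; split=> i; [case=> j; rewrite andbF | move=> /sub/=; lia].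
have P0 : exists i, (i == 0) || `[< S i >] by exists 0.
have Pn i : (i == 0) || `[< S i >] -> (i <= n)%N.
  by case/orP => [/eqP->//|/asboolP/sub/=]; lia.
case: (ex_maxnP P0 Pn) => i Pi maxi.
have ltin : (i < n)%N.
  by case/orP: Pi => [/eqP->//|/asboolP/sub/=]; lia.
have [|//|a [wa ca]] := IH i [set j | S j /\ (j < i)%N].
- by move=> j [/sub/= /andP[-> _] ->].
- exact: leq_trans ltin lenm.
have ni0 : (0 < n - i)%N by rewrite subn_gt0.
exists (rcons a (PosInt ni0)); split.
  by rewrite weight_rcons wa /= subnKC // ltnW.
apply/seteqP; split=> j.
  case/cset_rcons => [|[a0 ->]]; first by rewrite ca => -[].
  rewrite wa; case/orP: Pi => [/eqP i0|/asboolP//].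
  by have := weight_gt0 a0; rewrite wa i0.
move=> Sj; apply/cset_rcons; rewrite ca.
have : (j <= i)%N by apply: maxi; apply/orP; right; apply/asboolP.
rewrite leq_eqVlt => /orP[/eqP ji|ji]; last by left.
right; split; last by rewrite wa.
rewrite lt0n; apply/eqP => /size0nil a0.
by move: wa (sub _ Sj); rewrite a0 /weight big_nil ji => <-.
Qed.

Definition compl (a : compn) : compn :=
  comp_of (weight a) [set i | (0 < i < weight a)%N /\ ~ cset a i].

(* Monomials in the variables x_1, x_2, ... *)
Definition mon := {cmonom posint}.

Definition xpow (i : seq posint) (a : compn) : mon :=
  \big[mmul/mone]_(p <- zip i a) expcmn (ucm p.1) (p.2 : nat).

Section QSym.
Variable k : fieldType.

Definition pseries := mon -> k.

Definition pmul (f g : pseries) : pseries :=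
  fun m => \sum_(p \in [set p : mon * mon | mmul p.1 p.2 = m]) f p.1 * g p.2.

Definition psymmetric (f : pseries) :=
  forall s : posint -> posint, bijective s ->
  forall m m' : mon, (forall i, m' i = m (s i)) -> f m' = f m.

(* M_a as a power series: its coefficient at m counts the i_1 < ... < i_l
   with x_{i_1}^{a_1} ... x_{i_l}^{a_l} = m. *)
Definition Mseries (a : compn) : pseries :=
  fun m => \sum_(i \in [set i : seq posint |
    sorted (fun x y : posint => (x < y)%N) i /\ size i = size a])
    ((xpow i a == m)%:R : k).

(* {malg k[compn]} is QSym, with << a >> standing for M_a. *)
Definition series (f : {malg k[compn]}) : pseries :=
  fun m => \sum_(a <- msupp f) f@_a * Mseries a m.

Definition L (a : compn) : {malg k[compn]} :=
  \sum_(b \in [set b | weight b = weight a /\ cset a `<=` cset b])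
    (<< b >> : {malg k[compn]}).

Definition Delta : {malg k[compn]} -> {malg k[(compn * compn)%type]} :=
  linext (fun a => \sum_(j < (size a).+1)
    (<< (take j a, drop j a) >> : {malg k[(compn * compn)%type]})).

Definition Sym : set {malg k[compn]} := [set f | psymmetric (series f)].

(* The counit and the coassociativity and compatibility axioms restrict to a
   subspace without further conditions.  The product of f and g is the h whose
   power series is the product of those of f and g. *)
Record sub_bialgebra_of_Sym (A : set {malg k[compn]}) : Prop := SubBialgebra {
  sub_Sym : A `<=` Sym;
  sub_zero : A 0;
  sub_lin : forall c f g, A f -> A g -> A (c *: f + g);
  sub_one : A << [::] >>;
  sub_mul : forall f g, A f -> A g ->
    exists2 h, A h & series h = pmul (series f) (series g);
  sub_Delta : forall f, A f ->
    span [set t | exists f1 f2, [/\ A f1, A f2 & t = tensor f1 f2]] (Delta f)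
}.

Definition Des (w : word) : set nat :=
  let u := map posint_val w in
  [set i | (0 < i < size w)%N /\ (nth 0 u i.-1 > nth 0 u i)%N].

Definition descomp (w : word) : compn := comp_of (size w) (Des w).

Definition psi_le : {malg k[wpair]} -> {malg k[compn]} :=
  linext (fun b => L (descomp (wp_word b))).

Definition psi_gt : {malg k[wpair]} -> {malg k[compn]} :=
  linext (fun b => L (compl (descomp (wp_word b)))).

End QSym.

Arguments Kspace : clear implicits.
Arguments psi_le : clear implicits.
Arguments psi_gt : clear implicits.

(* Main.v *)
Require Import Defs.
From HB Require Import structures.
From mathcomp Require Import all_boot all_algebra finmap.
From mathcomp.multinomials Require Import monalg.
From mathcomp Require Import zify.
From mathcomp Require Import boolp classical_sets fsbigop.

Set Implicit Arguments.
Unset Strict Implicit.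
Unset Printing Implicit Defensive.

Import GRing.Theory.

(** The coefficient of [psi_le] of a class sum at the monomial function [M_b]
    counts the words of the class that are weakly increasing on consecutive
    blocks of lengths [b]; for [psi_gt] the blocks are strictly decreasing
    ([mcoeff_L_des], [mcoeff_L_compl_des]).  Comparing power series, an element
    of QSym lies in Sym iff its coefficient at [M_b] is invariant under
    rearrangement of [b] ([SymE]).

    Three facts reduce the theorem to the question whether the image of
    [psi_le] consists of symmetric functions.

    - Sym itself is a sub-bialgebra ([Sym_sub_bialgebra]).

    - Both images always contain Sym.  A homogeneous relation that respects
      restriction to single letters preserves the content of words, so the sum
      of all words of a given content is a sum of class sums.  Its image under
      [psi_gt] is a product of elementary symmetric functions.  These products
      are triangular with respect to the monomial symmetric functions, for the
      lexicographic order of compositions ([stair_code]), hence they span Sym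
      ([csym_sub_span]).

    - The involution of QSym sending [L a] to [L (compl a)] exchanges [psi_le]
      and [psi_gt].  On coefficients it is the signed sum [omega] over
      refinements, which visibly preserves symmetry ([csym_omega]).  So the
      image of [psi_le] lies in Sym iff that of [psi_gt] does, and the
      inclusion of Sym in the second image carries over to the first.

    Hence an image is a sub-bialgebra of Sym iff it equals Sym, and iff it is
    contained in Sym.

    If the relation extends Knuth equivalence, symmetry amounts to exchanging
    the lengths [p >= q] of two consecutive weakly increasing blocks inside a
    union of Knuth classes.  A two-row jeu de taquin slide moves one letter from
    the first block to the second, stays in the Knuth class ([knuth_slide]), and
    keeps the number of matched letters, so that it is injective and may be
    iterated [p - q] times ([switchP], [switch_inj]).  This gives an inequality
    of cardinalities for every union of Knuth classes.  For the set of all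
    rearrangements of a word there is equality, by simply transposing the two
    blocks; applying the inequality to a set and to its complement gives
    equality in general ([count_blocks_knuth]).

    Conversely, symmetry in degree three says that a class contains as many
    words with descent set [{1}] as with descent set [{2}].  This pairs the
    words of the Knuth relations, except that [bac] might be paired with [acb],
    or [bca] with [cab]; then restricting to the letters from [a] to [b] gives
    [ba ~ ab], hence [ca ~ ac], and the Knuth relations hold as well
    ([knuth_of_csym]). *)

(** * Knuth relations and two-row slides *)

Definition ple : rel posint := fun x y => (x <= y)%N.
Definition pgt : rel posint := fun x y => (y < x)%N.

Lemma ple_trans : transitive ple.
Proof. by move=> y x z; apply: leq_trans. Qed.

Lemma pgtE x y : pgt x y = ~~ ple x y.
Proof. by rewrite /pgt /ple ltnNge. Qed.

Lemma knuth_catl s v w : knuth v w -> knuth (s ++ v) (s ++ w).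
Proof. exact/knuth_cat/knuth_refl. Qed.

Lemma knuth_catr s v w : knuth v w -> knuth (v ++ s) (w ++ s).
Proof. by move/knuth_cat; apply; apply: knuth_refl. Qed.

Lemma knuth_cons a v w : knuth v w -> knuth (a :: v) (a :: w).
Proof. exact: (knuth_catl [:: a]). Qed.

Lemma knuth_bca_weak (a b c : posint) : pgt b a -> ple b c ->
  knuth [:: b; c; a] [:: b; a; c].
Proof.
move=> ab; rewrite /ple leq_eqVlt => /orP[/eqP/val_inj <-|bc].
  exact/knuth_sym/knuth_bab.
by apply/knuth_sym/knuth_bac/andP.
Qed.

Lemma knuth_acb_weak (a b c : posint) : ple a b -> pgt c b ->
  knuth [:: a; c; b] [:: c; a; b].
Proof.
rewrite /ple leq_eqVlt => /orP[/eqP/val_inj <-|ab] bc.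
  exact: knuth_aba.
by apply: knuth_acb; apply/andP.
Qed.

Lemma knuth_shift_left b w a : sorted ple (b :: w) -> pgt b a ->
  knuth (b :: rcons w a) (b :: a :: w).
Proof.
elim: w b => [|c w IH] b /=; first by move=> *; apply: knuth_refl.
move=> /andP[bc sw] ab.
have ac : pgt c a by rewrite /pgt; apply: leq_trans ab bc.
apply: knuth_trans (knuth_cons b (IH c sw ac)) _.
exact: (knuth_catr w (knuth_bca_weak ab bc)).
Qed.

Lemma knuth_shift_right r b c : sorted ple (rcons r b) -> pgt c b ->
  knuth (r ++ [:: c; b]) (c :: rcons r b).
Proof.
elim/last_ind: r b => [|r a IH] b; first by move=> *; apply: knuth_refl.
rewrite -!cats1 -!catA /= => srt cb.
have ab : ple a b.
  by move: srt; rewrite sorted_cat_cons => /andP[_] /= /andP[].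
have sra : sorted ple (rcons r a).
  by move: srt; rewrite -cat_rcons => /cat_sorted2[].
have ca : pgt c a by rewrite /pgt; apply: leq_ltn_trans ab cb.
apply: knuth_trans (knuth_catl r (knuth_acb_weak ab cb)) _.
have := knuth_catr [:: b] (IH a sra ca).
by rewrite -!cats1 -!catA /= -!catA.
Qed.

(** Row insertion of [b] into the row [r ++ c :: w], where [b] bumps [c]. *)
Lemma knuth_bump r c w b :
    sorted ple (rcons r b) -> sorted ple (c :: w) -> pgt c b ->
  knuth (r ++ c :: rcons w b) (c :: rcons r b ++ w).
Proof.
move=> srb scw cb.
apply: knuth_trans (knuth_catl r (knuth_shift_left scw cb)) _.
have := knuth_catr w (knuth_shift_right srb cb).
by rewrite -!cats1 -!catA /= -!catA.
Qed.

(** Inserting the letters of [y] into the row [r ++ z] bumps those of [z], one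
    after the other. *)
Lemma knuth_exchange r z y :
    all2 pgt z y -> sorted ple (r ++ y) -> sorted ple z ->
  knuth (r ++ z ++ y) (z ++ r ++ y).
Proof.
elim: z y r => [|c w IH] [|b y] r //=; first by move=> *; apply: knuth_refl.
move=> /andP[cb wy]; rewrite -cat_rcons => sry scw.
have [srb _] := cat_sorted2 sry.
have := knuth_catr y (knuth_bump srb scw cb).
rewrite -!cats1 -!catA /= -!catA /= => /knuth_trans; apply.
apply: knuth_cons; rewrite -!cat_rcons; apply: IH => //.
exact: path_sorted scw.
Qed.

(** A jeu de taquin slide stays in the Knuth class.  The lower row is
    [v ++ x :: z] and the upper row [u ++ y]; each pair in the columns of [v]
    and [u] is passed across [x] by two applications of [knuth_shift_left]. *)
Lemma knuth_slide v u x z y :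
    all2 pgt v u -> all2 pgt z y ->
    sorted ple (v ++ x :: z) -> sorted ple (x :: y) ->
  knuth (v ++ (x :: z) ++ u ++ y) (v ++ z ++ u ++ x :: y).
Proof.
elim: v u => [|b v IH] [|a u] //=.
  move=> _ zy sxz sxy; apply: (@knuth_exchange [:: x]) => //.
  exact: path_sorted sxz.
move=> /andP[ba vu] zy sbv sxy.
have sv : sorted ple (v ++ x :: z) by apply: path_sorted sbv.
have svz : sorted ple (b :: v ++ z).
  apply: (subseq_sorted ple_trans) (sbv : sorted ple (b :: v ++ x :: z)).
  by rewrite /= eqxx; apply: cat_subseq (subseq_cons _ _).
have := knuth_catr (u ++ y) (knuth_shift_left sbv ba).
rewrite -!cats1 /= -!catA /= => /knuth_trans; apply.
have := knuth_catl [:: b; a] (IH u vu zy sv sxy) => /knuth_trans; apply.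
have := knuth_catr (u ++ x :: y) (knuth_shift_left svz ba).
by rewrite -!cats1 /= -!catA /= => /knuth_sym.
Qed.

(** Jeu de taquin: a hole in the upper row stands above the first letter of the
    lower row [T] and to the left of the rest [V] of the upper row.  The smaller
    of its two neighbours moves in, the lower one in case of a tie, until a
    letter of [T] has moved up.  The last letter of [T] moves up in any case, so
    that exactly one letter always changes rows. *)
Fixpoint slide (T V : word) {struct T} : word * word :=
  match T with
  | [::] => ([::], V)
  | x :: T' =>
    if V isn't y :: V' then (T', x :: V) else
    if (T' == [::]) || ple x y then (T', x :: V) else
    let s := slide T' V' in (x :: s.1, y :: s.2)
  end.

Lemma perm_slide T V : perm_eq ((slide T V).1 ++ (slide T V).2) (T ++ V).
Proof.
elim: T V => [|x T IH] [|y V] //=; first by rewrite cats0 perm_catC.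
case: ifP => _ /=; first by rewrite (perm_catCA T [:: x]).
rewrite perm_cons (perm_catCA _ [:: y]) perm_sym (perm_catCA _ [:: y]).
by rewrite perm_cons perm_sym.
Qed.

Lemma size_slide T V : T != [::] ->
  size (slide T V).1 = (size T).-1 /\ size (slide T V).2 = (size V).+1.
Proof.
elim: T V => [|x T IH] // [|y V] _ //=; case: ifP => //= /norP[T0 _].
by case: (IH V T0) => -> ->; case: T T0 {IH}.
Qed.

(** The shapes to which [slide] applies: with the hole the columns are strict,
    and closing the hole by shifting all of [V] to the left would not give such a
    shape. *)
Definition slidable T V :=
  [&& T != [::], all2 pgt (behead T) (take (size T).-1 V)
    & ~~ all2 pgt T (take (size T) V)].

Lemma slidable_cons x T y V : T != [::] -> pgt x y ->
  slidable (x :: T) (y :: V) -> slidable T V.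
Proof.
case: T => // x' T _ xy; rewrite /slidable /= xy /= => /andP[/andP[_ ->]] /=.
by [].
Qed.

Lemma slideP T V : sorted ple T -> sorted ple V -> slidable T V ->
  exists v x z u y, [/\ T = v ++ x :: z, V = u ++ y,
    slide T V = (v ++ z, u ++ x :: y), all2 pgt v u
  & all2 pgt z (take (size z) y) && sorted ple (x :: y)].
Proof.
elim: T V => [|x T IH] // V sT sV; rewrite {1}/slidable /=.
case: V sV => [|y V] sV /=.
  case: T sT {IH} => // _ _.
  by exists [::], x, [::], [::], [::].
case: ifP => [|/negbT/norP[T0]].
  move=> C /andP[A B]; exists [::], x, T, [::], (y :: V); split=> //.
  rewrite A /=; apply/andP; split; last exact: sV.
  case/orP: C => // /eqP T0.
  by move: B; rewrite T0 /= take0 andbT pgtE negbK.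
rewrite -pgtE => xy sl; have sl' := slidable_cons T0 xy sl.
have [v [x' [z [u [y' [-> -> -> vu zy]]]]]] :=
  IH V (path_sorted sT) (path_sorted sV) sl'.
by exists (x :: v), x', z, (y :: u), y'; split=> //=; rewrite xy.
Qed.

Lemma slide_sorted T V : sorted ple T -> sorted ple V -> slidable T V ->
  sorted ple (slide T V).2.
Proof.
elim: T V => [|x T IH] // [|y V] //= sT sV.
case: ifP => [|/negbT/norP[T0]].
  move=> C /and3P[/= _ A B]; apply/andP; split; last exact: sV.
  case/orP: C => // /eqP T0.
  by move: B; rewrite T0 /= take0 andbT pgtE negbK.
rewrite -pgtE => xy sl; have sl' := slidable_cons T0 xy sl.
have sS := IH V (path_sorted sT) (path_sorted sV) sl'.
rewrite /= (path_sortedE ple_trans) sS andbT; apply/allP => a aS.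
have: a \in T ++ V.
  by rewrite -(perm_mem (perm_slide T V)) mem_cat aS orbT.
rewrite mem_cat => /orP[aT|aV].
  move: sT; rewrite (path_sortedE ple_trans) => /andP[/allP/(_ a aT) xa _].
  by apply: leq_trans xa; apply: ltnW.
by move: sV; rewrite (path_sortedE ple_trans) => /andP[/allP/(_ a aV)].
Qed.

Lemma all2_cat (A B : Type) (r : A -> B -> bool) s1 s2 t1 t2 :
    size s1 = size t1 ->
  all2 r (s1 ++ s2) (t1 ++ t2) = all2 r s1 t1 && all2 r s2 t2.
Proof. by elim: s1 t1 => [|a s IH] [|b t] //= [/IH ->]; rewrite andbA. Qed.

(** In the columns to the right of the letter [x] that moves up, the upper row
    shifts by one place to the right, so its letters get smaller. *)
Lemma slide_matched T V : sorted ple T -> sorted ple V -> slidable T V ->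
  all2 pgt (slide T V).1 (take (size T).-1 (slide T V).2).
Proof.
have shift x z y : all2 pgt z (take (size z) y) -> sorted ple (x :: y) ->
    all2 pgt z (take (size z) (x :: y)).
  elim: z x y => [|c z IH] x [|b y] //= /andP[cb zy] /andP[xb sy].
  by rewrite IH // andbT; apply: leq_ltn_trans xb cb.
move=> sT sV sl.
have [v [x [z [u [y [-> _ -> vu /andP[zy sy]]]]]]] := slideP sT sV sl.
rewrite /= size_cat /= addnS /=; have suv : size v = size u.
  by move: vu; rewrite all2E => /andP[/eqP].
rewrite suv take_cat ltnNge leq_addr /= addKn.
by rewrite all2_cat // vu shift.
Qed.

(** A slide does not create a further match: the letter [x] that moved up faces
    a letter which stood to its left in [a :: T], hence is at most [x]. *)
Lemma slide_unmatched a T V : sorted ple (a :: T) -> sorted ple V ->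
  slidable T V ->
  ~~ all2 pgt (a :: (slide T V).1) (take (size T) (slide T V).2).
Proof.
elim: T a V => [|x T IH] // a [|y V] /=.
  by move=> /andP[ax _] _ _; rewrite pgtE ax.
move=> /andP[ax sT] sV; case: ifP => [_ _|/negbT/norP[T0]].
  by rewrite /= pgtE ax.
rewrite -pgtE => xy sl; have sl' := slidable_cons T0 xy sl.
by rewrite /= negb_and (IH x V) ?orbT // (path_sorted sV).
Qed.

(** Slides with the same result stop in the same column.  Where one of them
    stops and the other one goes on, the first requires the rows that remain to
    match, and [slide_unmatched] denies this for the second. *)
Lemma slide_inj T1 V1 T2 V2 :
    sorted ple T1 -> sorted ple V1 -> slidable T1 V1 ->
    sorted ple T2 -> sorted ple V2 -> slidable T2 V2 ->
  slide T1 V1 = slide T2 V2 -> T1 = T2 /\ V1 = V2.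
Proof.
have mixed x1 T y1 V x2 S W : T != [::] -> sorted ple (x1 :: T) ->
    sorted ple V -> pgt x1 y1 -> slidable (x1 :: T) (y1 :: V) ->
    slidable (x2 :: S) W ->
    (x1 :: (slide T V).1, y1 :: (slide T V).2) <> (S, x2 :: W).
  move=> T0 sT sV xy sl1 sl2 [eS _ eW].
  have := slide_unmatched sT sV (slidable_cons T0 xy sl1).
  case/and3P: sl2 => _ matchS _; rewrite eS eW; apply/negP; rewrite negbK.
  move: matchS; rewrite -eS /=; case: (size_slide V T0) => -> _.
  by rewrite prednK //; case: (T) T0.
elim: T1 V1 T2 V2 => [|x1 T1 IH] // V1 [|x2 T2] // V2 sT1 sV1 sl1 sT2 sV2 sl2.
case: V1 sV1 sl1 => [|y1 V1] sV1 sl1; case: V2 sV2 sl2 => [|y2 V2] sV2 sl2 /=.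
- by case=> -> ->.
- case: ifP => [_ [-> ->]//|/negbT/norP[T0]].
  by rewrite -pgtE => xy /esym/mixed[] //; apply: path_sorted sV2.
- case: ifP => [_ [-> ->]//|/negbT/norP[T0]].
  by rewrite -pgtE => xy /mixed[] //; apply: path_sorted sV1.
case: ifP => [_|/negbT/norP[T10]]; last rewrite -pgtE => xy1.
  case: ifP => [_ [-> -> -> ->]//|/negbT/norP[T0]].
  by rewrite -pgtE => xy /esym/mixed[] //; apply: path_sorted sV2.
case: ifP => [_|/negbT/norP[T20]]; last rewrite -pgtE => xy2.
  by move=> /mixed[] //; apply: path_sorted sV1.
case=> -> e1 -> e2.
have [|||||||-> ->] // := IH V1 T2 V2.
- exact: path_sorted sT1.
- exact: path_sorted sV1.
- exact: slidable_cons sl1.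
- exact: path_sorted sT2.
- exact: path_sorted sV2.
- exact: slidable_cons sl2.
by rewrite [LHS]surjective_pairing [RHS]surjective_pairing e1 e2.
Qed.

(** In tableau terms, [U] is placed as a lower row under the upper row [V] so
    that they overlap in [m] columns, which are strictly increasing. *)
Definition matched (U V : word) m :=
  (m <= size U) && all2 pgt (drop (size U - m) U) (take m V).

(** By monotonicity of [matched], the second half says that [m] is the largest
    number of matched letters. *)
Definition rows m (UV : word * word) :=
  [&& sorted ple UV.1, sorted ple UV.2, matched UV.1 UV.2 m
    & ~~ matched UV.1 UV.2 m.+1].

(** One slide with the last [m.+1] letters of [U] as lower row: on two-row
    arrays, a lowering operator of the crystal of type [A_1]. *)
Definition move m (UV : word * word) :=
  let d := size UV.1 - m.+1 in
  let s := slide (drop d UV.1) UV.2 in (take d UV.1 ++ s.1, s.2).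

Definition match_number (U V : word) :=
  find (fun m => ~~ matched U V m.+1) (iota 0 (size U).+1).

Lemma match_numberP U V : sorted ple U -> sorted ple V ->
  rows (match_number U V) (U, V).
Proof.
move=> sU sV; rewrite /rows /= sU sV /=; rewrite /match_number.
set a := fun m => _; set s := iota _ _.
have hs : has a s.
  by apply/hasP; exists (size U); rewrite ?mem_iota ?leqnn //= /a /matched ltnn.
have lts : (find a s < (size U).+1)%N by rewrite -(size_iota 0 (size U).+1) -has_find.
have := nth_find 0 hs; rewrite nth_iota // add0n => fa.
apply/andP; split; last exact: fa.
case def_m: (find a s) => [|m].
  by rewrite /matched /= subn0 drop_size take0.
have : (m < find a s)%N by rewrite def_m.
move/(before_find 0); rewrite nth_iota; last by rewrite -def_m in lts *; lia.
by rewrite add0n /a => /negbFE.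
Qed.

Lemma matched_pred U V m : sorted ple U -> matched U V m.+1 -> matched U V m.
Proof.
move=> sU /andP[ltmU mt]; rewrite /matched (ltnW ltmU) /=.
have -> : size U - m = (size U - m.+1).+1 by lia.
have sz : size (drop (size U - m.+1) U) = m.+1 by rewrite size_drop; lia.
rewrite -add1n -drop_drop drop1.
move: mt sz (drop_sorted (size U - m.+1) sU).
set T := drop _ U; clearbody T => {sU ltmU U}.
elim: T m V => [|x T IH] // [|m] [|y V] //= /andP[xy mt] [sz].
  by rewrite (size0nil sz).
case: T IH mt sz => // x' T IH mt sz /andP[xx' sT].
have /= := IH m V mt sz sT.
by move=> ->; rewrite andbT; apply: leq_trans xy xx'.
Qed.

Lemma matched_leq U V m n : sorted ple U -> (m <= n)%N -> matched U V n ->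
  matched U V m.
Proof.
move=> sU; elim: n => [|n IH]; first by rewrite leqn0 => /eqP ->.
rewrite leq_eqVlt => /orP[/eqP -> //|lemn] /(matched_pred sU); exact: IH.
Qed.

Lemma rows_uniq m n UV : rows m UV -> rows n UV -> m = n.
Proof.
move=> /and4P[sU _ mm nm] /and4P[_ _ mn nn].
case: (ltngtP m n) => // lt.
  by rewrite (matched_leq sU lt mn) in nm.
by rewrite (matched_leq sU lt mm) in nn.
Qed.

Lemma rows_le m UV : rows m UV -> (m <= size UV.1)%N /\ (m <= size UV.2)%N.
Proof.
case/and4P=> _ _ /andP[leU]; rewrite all2E => /andP[+ _] _; rewrite leU.
rewrite size_drop size_take; case: ltnP => // [/ltnW //|_].
by rewrite subKn // => /eqP <-.
Qed.

Lemma slidable_rows m U V : rows m (U, V) -> (m < size U)%N ->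
  slidable (drop (size U - m.+1) U) V.
Proof.
case/and4P=> /= sU sV /andP[leU mt] nm ltU.
have sz : size (drop (size U - m.+1) U) = m.+1 by rewrite size_drop; lia.
move: nm; rewrite /matched ltU /slidable sz /= => ->; rewrite andbT.
rewrite -size_eq0 sz /= -drop1 drop_drop.
by have -> : (1 + (size U - m.+1) = size U - m)%N by lia.
Qed.

Section Move.
Variables (m : nat) (U V : word).
Hypotheses (rUV : rows m (U, V)) (ltU : (m < size U)%N).

Let d := size U - m.+1.
Let T := drop d U.
Let sT : sorted ple T. Proof. by case/and4P: rUV => /(drop_sorted d). Qed.
Let sU : sorted ple U. Proof. by case/and4P: rUV. Qed.
Let sV : sorted ple V. Proof. by case/and4P: rUV. Qed.
Let slT : slidable T V := slidable_rows rUV ltU.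
Let szT : size T = m.+1. Proof. by rewrite /T size_drop /d; lia. Qed.
Let T0 : T != [::]. Proof. by rewrite -size_eq0 szT. Qed.

Lemma size_move : size (move m (U, V)).1 = (size U).-1 /\
  size (move m (U, V)).2 = (size V).+1.
Proof.
rewrite /move /= -/d -/T; have [e1 e2] := size_slide V T0; split=> //.
by rewrite size_cat e1 szT size_take /d; case: ltnP; lia.
Qed.

Lemma knuth_move : knuth (U ++ V) ((move m (U, V)).1 ++ (move m (U, V)).2).
Proof.
rewrite /move /= -/d -/T -{1}(cat_take_drop d U) -/T -!catA.
apply: knuth_catl.
have [v [x [z [u [y [eT -> -> /= vu /andP[zy sxy]]]]]]] := slideP sT sV slT.
have sT' := sT; rewrite eT in sT' *.
set t := drop (size z) y; have ey : y = take (size z) y ++ t.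
  by rewrite cat_take_drop.
have sxt : sorted ple (x :: take (size z) y).
  by move: sxy; rewrite {1}ey /= cat_path => /andP[].
have := knuth_catr t (knuth_slide vu zy sT' sxt).
by rewrite -!catA /= -?catA -ey.
Qed.

(** The number of matched letters is invariant, which makes it possible to
    iterate [move] and to invert it. *)
Lemma rows_move : rows m (move m (U, V)).
Proof.
have [size1 size2] := size_move.
rewrite /rows; apply/and4P; split.
- rewrite /move /= -/d -/T; apply: (subseq_sorted ple_trans) (_ : sorted ple U).
    rewrite -{2}(cat_take_drop d U) cat_subseq //.
    have [v [x [z [u [y [eT _ -> _ _]]]]]] := slideP sT sV slT.
    by rewrite -/T eT; apply: cat_subseq (subseq_cons _ _).
  by case/and4P: rUV.
- exact: slide_sorted sT sV slT.
- rewrite /matched size1 /move /= -/d -/T.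
  apply/andP; split; first by lia.
  have -> : (size U).-1 - m = size (take d U) by rewrite size_take /d; case: ltnP; lia.
  by rewrite drop_size_cat //; have := slide_matched sT sV slT; rewrite szT.
rewrite /matched size1; apply/negP => /andP[ltm].
have d0 : (0 < d)%N by rewrite /d; lia.
rewrite /move /= -/d -/T.
have sztd : size (take d U) = d by rewrite size_take /d; case: ltnP; lia.
have -> : (size U).-1 - m.+1 = d.-1 by rewrite /d; lia.
move: sU sztd; rewrite -{1}(cat_take_drop d U) -/T.
case/lastP: (take d U) => [|P a]; first by move=> _ /= d0'; rewrite -d0' in d0.
rewrite size_rcons -cats1 -!catA /= => /cat_sorted2[_ saT] sP.
rewrite -sP /= drop_size_cat //.
by have := slide_unmatched saT sV slT; rewrite szT => /negP.
Qed.
End Move.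

Lemma move_inj m U1 V1 U2 V2 : rows m (U1, V1) -> (m < size U1)%N ->
  rows m (U2, V2) -> (m < size U2)%N ->
  move m (U1, V1) = move m (U2, V2) -> (U1, V1) = (U2, V2).
Proof.
move=> r1 lt1 r2 lt2 e.
have [s1 _] := size_move r1 lt1; have [s2 _] := size_move r2 lt2.
have eU : size U1 = size U2 by move: s1; rewrite e s2; lia.
move: e; rewrite /move /= eU; set d := size U2 - m.+1 => -[].
have st1 : size (take d U1) = size (take d U2) by rewrite !size_take eU.
move/eqP; rewrite eqseq_cat // => /andP[/eqP et /eqP es1] es2.
have sl1 := slidable_rows r1 lt1; have sl2 := slidable_rows r2 lt2.
rewrite eU in sl1.
case/and4P: r1 => /= sU1 sV1 _ _; case/and4P: r2 => /= sU2 sV2 _ _.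
have [|||||||eT ->] := @slide_inj (drop d U1) V1 (drop d U2) V2; rewrite ?drop_sorted //.
  by rewrite [LHS]surjective_pairing [RHS]surjective_pairing es1 es2.
by rewrite -(cat_take_drop d U1) et eT cat_take_drop.
Qed.

Section MoveIter.
Variables (m n : nat) (U V : word).
Hypotheses (rUV : rows m (U, V)) (ltU : (m + n <= size U)%N).

Lemma iter_moveP : let UV := iter n (move m) (U, V) in
  [/\ rows m UV, size UV.1 = size U - n, size UV.2 = size V + n
    & knuth (U ++ V) (UV.1 ++ UV.2)].
Proof.
move: ltU; elim: n => [|i IH] /=.
  by move=> _; rewrite subn0 addn0; split=> //; apply: knuth_refl.
rewrite addnS => lti; have [] := IH (ltnW lti).
set X := iter i _ _; case: X => U' V' /= r' sU' sV' kn.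
have lt' : (m < size U')%N by rewrite sU'; lia.
have [-> ->] := size_move r' lt'; split; [exact: rows_move|lia|lia|].
exact: knuth_trans kn (knuth_move r' lt').
Qed.

End MoveIter.

Lemma iter_move_inj m n UV1 UV2 :
    rows m UV1 -> (m + n <= size UV1.1)%N ->
    rows m UV2 -> (m + n <= size UV2.1)%N ->
  iter n (move m) UV1 = iter n (move m) UV2 -> UV1 = UV2.
Proof.
case: UV1 UV2 => [U1 V1] [U2 V2] /= r1 lt1 r2 lt2.
elim: n lt1 lt2 => [|n IH] //=; rewrite !addnS => lt1 lt2 e.
apply: IH; try exact: ltnW.
have [r1' s1 _ _] := iter_moveP r1 (ltnW lt1).
have [r2' s2 _ _] := iter_moveP r2 (ltnW lt2).
move: e r1' s1 r2' s2; case: (iter n _ _) => A B; case: (iter n _ _) => C D /=.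
by move=> e r1' s1 r2' s2; apply: move_inj e => //; rewrite ?s1 ?s2; lia.
Qed.

(** The reflection operator of the crystal: all the surplus letters of the longer
    row [U] move to [V]. *)
Definition switch (U V : word) : word * word :=
  iter (size U - size V) (move (match_number U V)) (U, V).

Lemma switchP U V : sorted ple U -> sorted ple V -> (size V <= size U)%N ->
  [/\ sorted ple (switch U V).1, sorted ple (switch U V).2,
      size (switch U V).1 = size V /\ size (switch U V).2 = size U
    & knuth (U ++ V) ((switch U V).1 ++ (switch U V).2)].
Proof.
move=> sU sV leVU; have r := match_numberP sU sV; have [/= le1 le2] := rows_le r.
have le : (match_number U V + (size U - size V) <= size U)%N by lia.
have [/and4P[? ? _ _] s1 s2 kn] := iter_moveP r le; split=> //.
by split; rewrite /switch ?s1 ?s2; lia.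
Qed.

Lemma switch_inj U1 V1 U2 V2 :
    sorted ple U1 -> sorted ple V1 -> sorted ple U2 -> sorted ple V2 ->
    size U1 = size U2 -> size V1 = size V2 -> (size V1 <= size U1)%N ->
  switch U1 V1 = switch U2 V2 -> (U1, V1) = (U2, V2).
Proof.
move=> sU1 sV1 sU2 sV2 eU eV le; rewrite /switch -eU -eV.
have r1 := match_numberP sU1 sV1; have [/= le1 le1'] := rows_le r1.
have r2 := match_numberP sU2 sV2; have [/= le2 le2'] := rows_le r2.
have lt1 : (match_number U1 V1 + (size U1 - size V1) <= size U1)%N by lia.
have lt2 : (match_number U2 V2 + (size U1 - size V1) <= size U2)%N by lia.
move=> e; have em : match_number U1 V1 = match_number U2 V2.
  have [R1 _ _ _] := iter_moveP r1 lt1.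
  have [R2 _ _ _] := iter_moveP r2 lt2.
  by rewrite e in R1; apply: rows_uniq R1 R2.
rewrite -em in r2 lt2 e; exact: iter_move_inj r1 lt1 r2 lt2 e.
Qed.

(** * Counting words by their blocks *)

Lemma weight_nil : weight [::] = 0%N.
Proof. by rewrite /weight big_nil. Qed.

Lemma weight_cons x b : weight (x :: b) = (x + weight b)%N.
Proof. by rewrite /weight big_cons. Qed.

Lemma weight_cat a b : weight (a ++ b) = (weight a + weight b)%N.
Proof. by rewrite /weight big_cat. Qed.

Lemma weight_perm a b : perm_eq a b -> weight a = weight b.
Proof. exact: perm_big. Qed.

Fixpoint blocks (r : rel posint) (b : compn) (w : word) {struct b} : bool :=
  if b is x :: b' then
    [&& (x <= size w)%N, sorted r (take x w) & blocks r b' (drop x w)]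
  else w == [::].

Lemma blocks_size r b w : blocks r b w -> size w = weight b.
Proof.
elim: b w => [|x b IH] w /=; first by rewrite weight_nil => /eqP ->.
by move=> /and3P[lex _ /IH]; rewrite size_drop weight_cons => <-; rewrite subnKC.
Qed.

Lemma blocks_cons r (x : posint) b U w : size U = x ->
  blocks r (x :: b) (U ++ w) = sorted r U && blocks r b w.
Proof.
by move=> sU /=; rewrite size_cat sU leq_addr take_size_cat ?drop_size_cat.
Qed.

Lemma blocks_cat r a b w1 w2 : size w1 = weight a ->
  blocks r (a ++ b) (w1 ++ w2) = blocks r a w1 && blocks r b w2.
Proof.
elim: a w1 => [|x a IH] w1 /=.
  by rewrite weight_nil => /size0nil ->.
rewrite weight_cons => sz; have lex : (x <= size w1)%N by rewrite sz leq_addr.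
rewrite size_cat (leq_trans lex (leq_addr _ _)) lex takel_cat // drop_cat.
case: ltnP => [_|ge].
  by rewrite IH ?andbA // size_drop sz addKn.
have ex : size w1 = x :> nat by apply/eqP; rewrite eqn_leq ge.
have a0 : weight a = 0%N by lia.
rewrite ex subnn drop0 drop_oversize ?ex // -{1}(cat0s w2) IH ?a0 //.
by rewrite /= andbA.
Qed.

Lemma blocks_split r b1 (x y : posint) b2 w :
    blocks r (b1 ++ x :: y :: b2) w ->
  exists w1 U V w2, [/\ w = w1 ++ U ++ V ++ w2, size w1 = weight b1,
    blocks r b1 w1 && blocks r b2 w2, sorted r U /\ size U = x
    & sorted r V /\ size V = y].
Proof.
move=> bw; have := blocks_size bw; rewrite weight_cat !weight_cons => sz.
move: bw; rewrite -(cat_take_drop (weight b1) w).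
set w1 := take _ _; set w' := drop _ _.
have s1 : size w1 = weight b1 by rewrite size_takel //; lia.
have s' : size w' = (x + (y + weight b2))%N by rewrite size_drop; lia.
rewrite blocks_cat // => /andP[bw1 bw'].
move: bw'; rewrite -(cat_take_drop x w').
set U := take _ _; set w'' := drop _ _.
have sU : size U = x by rewrite size_takel //; lia.
have s'' : size w'' = (y + weight b2)%N by rewrite size_drop; lia.
rewrite blocks_cons // => /andP[srU].
rewrite -(cat_take_drop y w'') blocks_cons; last by rewrite size_takel //; lia.
move=> /andP[srV bw2]; exists w1, U, (take y w''), (drop y w''); split=> //.
  by rewrite bw1.
by rewrite size_takel //; lia.
Qed.

Lemma blocks_join r b1 (x y : posint) b2 w1 U V w2 :
    size w1 = weight b1 -> size U = x -> size V = y ->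
  blocks r (b1 ++ x :: y :: b2) (w1 ++ U ++ V ++ w2) =
    [&& blocks r b1 w1, sorted r U, sorted r V & blocks r b2 w2].
Proof. by move=> s1 sU sV; rewrite blocks_cat // !blocks_cons. Qed.

Lemma count_leq_inj (T : eqType) (s : seq T) (p q : pred T) (f : T -> T) :
    uniq s -> {in [pred z | p z && (z \in s)] &, injective f} ->
    (forall z, p z -> z \in s -> q (f z) && (f z \in s)) ->
  (count p s <= count q s)%N.
Proof.
move=> us inj mapf; rewrite -!size_filter -(size_map f); apply: uniq_leq_size.
  rewrite map_inj_in_uniq ?filter_uniq // => z t; rewrite !mem_filter => hz ht.
  exact: inj.
by move=> _ /mapP[z + ->]; rewrite !mem_filter => /andP[pz zs]; apply: mapf.
Qed.

(** A map [phi] on pairs of chains that exchanges their lengths acts on the words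
    with blocks [b1 ++ x :: y :: b2] through the two middle blocks. *)
Section BlockMap.
Variables (r : rel posint) (b1 b2 : compn) (x y : posint) (P : pred word).
Variables (u : word) (phi : word -> word -> word * word).

Hypothesis phiP : forall U V, sorted r U -> sorted r V ->
  size U = x -> size V = y ->
  [/\ sorted r (phi U V).1 /\ size (phi U V).1 = y,
      sorted r (phi U V).2 /\ size (phi U V).2 = x
    & forall w1 w2, let w := w1 ++ U ++ V ++ w2 in
      let w' := w1 ++ (phi U V).1 ++ (phi U V).2 ++ w2 in
      perm_eq w' w /\ (P w -> P w')].
Hypothesis phi_inj : forall U V U' V',
  sorted r U -> sorted r V -> sorted r U' -> sorted r V' ->
  size U = x -> size V = y -> size U' = x -> size V' = y ->
  phi U V = phi U' V' -> (U, V) = (U', V').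

Let on_blocks w :=
  let n := weight b1 in
  let UV := phi (take x (drop n w)) (take y (drop (n + x) w)) in
  take n w ++ UV.1 ++ UV.2 ++ drop (n + x + y) w.

Let on_blocksE w1 U V w2 : size w1 = weight b1 -> size U = x -> size V = y ->
  on_blocks (w1 ++ U ++ V ++ w2) = w1 ++ (phi U V).1 ++ (phi U V).2 ++ w2.
Proof.
move=> s1 sU sV; rewrite /on_blocks.
have -> : drop (weight b1 + x + y) (w1 ++ U ++ V ++ w2) = w2.
  by rewrite 2!catA drop_size_cat // !size_cat s1 sU sV.
have -> : drop (weight b1 + x) (w1 ++ U ++ V ++ w2) = V ++ w2.
  by rewrite catA drop_size_cat // size_cat s1 sU.
by rewrite take_size_cat // drop_size_cat // !take_size_cat.
Qed.

Lemma count_blocks_leq :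
  (count (fun w => P w && blocks r (b1 ++ x :: y :: b2) w) (permutations u) <=
   count (fun w => P w && blocks r (b1 ++ y :: x :: b2) w) (permutations u))%N.
Proof.
apply: (count_leq_inj (f := on_blocks)); first exact: permutations_uniq.
  move=> w w' /= /andP[/andP[_ /blocks_split[w1 [U [V [w2 [-> s1 _ [srU sU] [srV sV]]]]]]] _].
  move=> /andP[/andP[_ /blocks_split[w1' [U' [V' [w2' [-> s1' _ [srU' sU'] [srV' sV']]]]]]] _].
  rewrite !on_blocksE //.
  have [[_ t1] [_ t2] _] := phiP srU srV sU sV.
  have [[_ t1'] [_ t2'] _] := phiP srU' srV' sU' sV'.
  move/eqP; rewrite !eqseq_cat ?s1 ?t1 ?t2 //.
  move=> /and4P[/eqP-> /eqP e1 /eqP e2 /eqP->].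
  have : phi U V = phi U' V'.
    by rewrite [LHS]surjective_pairing e1 e2 -surjective_pairing.
  by move/(phi_inj srU srV srU' srV' sU sV sU' sV') => [-> ->].
move=> w /andP[Pw /blocks_split[w1 [U [V [w2 [ew s1 /andP[bw1 bw2] [srU sU] [srV sV]]]]]]].
rewrite !mem_permutations ew on_blocksE // => pw.
have [[t1 s1'] [t2 s2'] /(_ w1 w2)[pp PP]] := phiP srU srV sU sV.
rewrite PP ?ew -?ew // blocks_join // bw1 t1 t2 bw2 /=.
by rewrite (perm_trans pp) // ew.
Qed.
End BlockMap.

Lemma count_blocks_swap r b1 x y b2 u :
  count (blocks r (b1 ++ x :: y :: b2)) (permutations u) =
  count (blocks r (b1 ++ y :: x :: b2)) (permutations u).
Proof.
pose swap (U V : word) := (V, U).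
have le x' y' : (count (blocks r (b1 ++ x' :: y' :: b2)) (permutations u) <=
    count (blocks r (b1 ++ y' :: x' :: b2)) (permutations u))%N.
  apply: (@count_blocks_leq r b1 b2 x' y' predT u swap).
    move=> U V sU sV eU eV; split=> //= w1 w2; split=> //.
    by rewrite perm_cat2l perm_catCA.
  by move=> U V U' V' _ _ _ _ _ _ _ _ [-> ->].
by apply/eqP; rewrite eqn_leq !le.
Qed.

Lemma knuth_perm v w : knuth v w -> perm_eq v w.
Proof.
elim=> {v w} [v|v w _|u v w _ uv _ vw|v v' w w' _ + _|a b c _|a b c _|a b _|a b _] //.
- by rewrite perm_sym.
- exact: perm_trans uv vw.
- by move=> *; apply: perm_cat.
- by rewrite perm_cons (perm_catC [:: a] [:: c]).
- by rewrite (perm_catCA [:: a] [:: c] [:: b]).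
- by rewrite (perm_catCA [:: a] [:: b] [:: a]).
- by rewrite perm_cons (perm_catC [:: a] [:: b]).
Qed.

(** Both [P] and its complement satisfy the inequality that [switch] yields, and
    the sum of the two counts is unchanged when the block lengths [x] and [y]
    are exchanged; so both inequalities are equalities. *)
Lemma count_blocks_knuth (P : pred word) b1 x y b2 u :
    (forall v w, knuth v w -> P v = P w) ->
  count (fun w => P w && blocks ple (b1 ++ x :: y :: b2) w) (permutations u) =
  count (fun w => P w && blocks ple (b1 ++ y :: x :: b2) w) (permutations u).
Proof.
move=> knP; wlog lyx : x y / (y <= x)%N.
  by move=> H; case/orP: (leq_total y x) => [/H //|/H ->].
have le Q : (forall v w, knuth v w -> Q v = Q w) ->
  (count (fun w => Q w && blocks ple (b1 ++ x :: y :: b2) w) (permutations u) <=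
   count (fun w => Q w && blocks ple (b1 ++ y :: x :: b2) w) (permutations u))%N.
  move=> knQ; apply: (@count_blocks_leq ple b1 b2 x y Q u switch).
    move=> U V sU sV eU eV; have [|s1 s2 [z1 z2] kn] := switchP sU sV.
      by rewrite eU eV.
    split; rewrite ?z1 ?z2 // => w1 w2 w w'.
    have kn' : knuth w w'.
      by apply: knuth_catl; rewrite !catA; apply: knuth_catr.
    by rewrite (knQ _ _ kn') perm_sym knuth_perm.
  move=> U V U' V' sU sV sU' sV' zU zV zU' zV'; apply: switch_inj => //.
  - by rewrite zU.
  - by rewrite zV.
  - by rewrite zU zV.
have := le P knP; have := le (predC P) (fun v w kn => congr1 negb (knP v w kn)).
have split_count b : count (blocks ple b) (permutations u) =
  (count (fun w => P w && blocks ple b w) (permutations u) +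
   count (fun w => predC P w && blocks ple b w) (permutations u))%N.
  elim: (permutations u) => //= w s ->.
  by case: (P w) => /=; [rewrite add0n addnA | rewrite add0n addnCA].
have := count_blocks_swap ple b1 x y b2 u; rewrite !split_count; lia.
Qed.

Local Open Scope classical_set_scope.
Local Open Scope ring_scope.

(** * Compositions and their refinements *)

Definition pone : posint := PosInt (isT : (0 < 1)%N).
Definition psucc (x : posint) : posint := PosInt (ltn0Sn x).

Definition bump_head (c : compn) : option compn :=
  if c is x :: c' then Some (psucc x :: c') else None.

Fixpoint comps n : seq compn :=
  if n is n'.+1 then map (cons pone) (comps n') ++ pmap bump_head (comps n')
  else [:: [::]].

Lemma mem_comps n c : (c \in comps n) = (weight c == n).
Proof.
elim: n c => [|n IH] [|x c] /=.
- by rewrite weight_nil.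
- by rewrite weight_cons inE; case: x => [[]].
- by rewrite weight_nil mem_cat mem_pmap; apply/negP => /orP[/mapP[]//|/mapP[[]//]].
rewrite mem_cat mem_pmap weight_cons; case: x => [[//|[|x]] x0] /=.
  have -> : PosInt x0 = pone by apply: val_inj.
  rewrite mem_map ?IH; last by move=> ? ? [].
  rewrite add1n eqSS; case: eqP => //= _.
  by apply/negP => /mapP[[//|[[//|y] y0] d] _ []].
have x1 : (0 < x.+1)%N by [].
have e : PosInt x0 = psucc (PosInt x1) by apply: val_inj.
rewrite (_ : _ \in map _ _ = false) /=; last by apply/negP => /mapP[d _ [] ].
rewrite [RHS](_ : _ = (weight (PosInt x1 :: c) == n)); last first.
  by rewrite weight_cons /= addSn eqSS.
rewrite -IH; apply/mapP/idP => [[[//|y d] dn [ey ->]]|cn].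
  by have -> : PosInt x1 = y by apply: val_inj => /=; case: ey.
by exists (PosInt x1 :: c); rewrite //= -e.
Qed.

Lemma uniq_comps n : uniq (comps n).
Proof.
elim: n => //= n IH; rewrite cat_uniq map_inj_uniq ?IH /=; last by move=> ? ? [].
apply/andP; split.
  apply/hasPn => c; rewrite mem_pmap => /mapP[[//|y d] _ [->]].
  by apply/negP => /mapP[e _ [] ]; case: y => [[]].
pose g (c : compn) := if c is x :: c' then insubd pone (x : nat).-1 :: c' else [::].
apply: (@pmap_uniq _ _ _ g) => // -[//|x c] /=; congr cons.
by apply: val_inj; rewrite /= val_insubd /=; case: x => [[]].
Qed.

Fixpoint refs (g : compn) : seq compn :=
  if g is x :: g' then [seq b ++ c | b <- comps x, c <- refs g'] else [:: [::]].

(** Invariance under rearrangement only needs to be tested on adjacent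
    transpositions. *)
Lemma adjacent_swaps_perm (T : Type) (F : compn -> T) :
    (forall a x y b, F (a ++ x :: y :: b) = F (a ++ y :: x :: b)) ->
  forall a b, perm_eq a b -> F a = F b.
Proof.
move=> swapF; have front p x s t : F (p ++ s ++ x :: t) = F (p ++ x :: s ++ t).
  elim/last_ind: s t => [|s y IH] t //=.
  by rewrite cat_rcons catA swapF -catA IH cat_rcons.
suff gen p a b : perm_eq a b -> F (p ++ a) = F (p ++ b) by exact: (gen [::]).
elim: a p b => [|x a IH] p b; first by rewrite perm_sym => /perm_nilP ->.
move=> pab; have xb : x \in b by rewrite -(perm_mem pab) mem_head.
case/splitPr: xb pab => b1 b2; rewrite perm_sym (perm_catCA b1 [:: x] b2) /=.
by rewrite perm_cons perm_sym front -!cat_rcons => /IH.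
Qed.

Section Omega.
Variable k : fieldType.
Implicit Types F : compn -> k.

Definition csym F := forall a b, perm_eq a b -> F a = F b.

Definition csign (b : compn) : k := (-1) ^+ (weight b + size b).

Lemma csign_cat a b : csign (a ++ b) = csign a * csign b.
Proof. by rewrite /csign weight_cat size_cat addnACA exprD. Qed.

(** Coefficients on the monomial basis of the image, under the involution
    [L a |-> L (compl a)], of the element with coefficients [F]. *)
Definition omega F : compn -> k := fun g => \sum_(b <- refs g) csign b * F b.

Lemma big_refs_cat g h (G : compn -> k) :
  \sum_(b <- refs (g ++ h)) G b =
  \sum_(b <- refs g) \sum_(c <- refs h) G (b ++ c).
Proof.
elim: g G => [|x g IH] G /=; first by rewrite big_seq1.
rewrite !big_allpairs_dep; apply: eq_bigr => b _.
by rewrite IH; apply: eq_bigr => c _; apply: eq_bigr => d _; rewrite catA.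
Qed.

Lemma csym_omega F : csym F -> csym (omega F).
Proof.
move=> symF; apply: adjacent_swaps_perm => a x y b; rewrite /omega.
rewrite !big_refs_cat; apply: eq_bigr => c _ /=; rewrite !big_allpairs_dep.
under eq_bigr do rewrite big_allpairs_dep.
under [RHS]eq_bigr do rewrite big_allpairs_dep.
rewrite exchange_big; do 3![apply: eq_bigr => ? _].
rewrite !csign_cat; congr (_ * _); first by congr (_ * _); rewrite !mulrA [X in X * _]mulrC.
by apply: symF; rewrite perm_cat2l perm_catCA.
Qed.

Lemma csign_pone c : csign (pone :: c) = csign c.
Proof. by rewrite /csign weight_cons /= add1n addSn addnS 2!exprS !mulN1r opprK. Qed.

Lemma csign_bump x c : csign (psucc x :: c) = - csign (x :: c).
Proof. by rewrite /csign !weight_cons /= !addSn exprS mulN1r. Qed.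

Lemma blocks_bump r x c a a' U :
  blocks r (psucc x :: c) (a :: a' :: U) = r a a' && blocks r (x :: c) (a' :: U).
Proof.
case: x => [[//|x] x0] /=; rewrite !ltnS; case: leqP => //= _; last by rewrite andbF.
by rewrite -!andbA.
Qed.

Section Negation.
Variables r r' : rel posint.
Hypothesis r'E : forall x y, r' x y = ~~ r x y.

(** Split the compositions by whether their first part is 1.  Both kinds reduce
    to the compositions for the tail of the word, with opposite signs, which
    leaves a factor [1 - r a a'] for the first two letters. *)
Lemma omega_row a U :
  \sum_(b <- comps (size (a :: U))) csign b * (blocks r b (a :: U))%:R =
  (sorted r' (a :: U))%:R.
Proof.
elim: U a => [|a' U IH] a.
  by rewrite /= big_seq1 csign_pone /csign weight_nil /= !mulr1.
have := IH a'; set V := a' :: U => IH'.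
rewrite [size (a :: V)]/= [comps _.+1]/= big_cat /= big_map.
rewrite [X in X + _](_ : _ = (sorted r' V)%:R); last first.
  by rewrite -IH'; apply: eq_bigr => b _; rewrite csign_pone /= ?take0 ?drop0.
rewrite [X in _ + X](_ : _ = - ((r a a')%:R * (sorted r' V)%:R)); last first.
  rewrite -IH' mulr_sumr -sumrN big_pmap; apply: eq_bigr => -[|x b].
    by move=> _; rewrite /= !mulr0 oppr0.
  move=> _.
  transitivity (csign (psucc x :: b) * (blocks r (psucc x :: b) (a :: V))%:R) => //.
  rewrite csign_bump blocks_bump.
  by rewrite mulNr mulrCA -natrM mulnb.
by rewrite /= r'E; case: (r a a'); rewrite ?mul1r ?subrr // mul0r subr0.
Qed.

(** The signed sum over refinements factors over the blocks of [g], so that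
    [omega_row] applies to each of them. *)
Lemma omega_blocks w g :
  omega (fun b => (blocks r b w)%:R) g = (blocks r' g w)%:R.
Proof.
rewrite /omega; elim: g w => [|x g IH] w.
  by rewrite /= big_seq1 /csign weight_nil mul1r.
rewrite [refs _]/= big_allpairs_dep; case: (ltnP (size w) x) => [ltwx|lexw].
  rewrite [blocks _ _ _]/= leqNgt ltwx /=.
  rewrite big_seq big1 // => b; rewrite mem_comps => /eqP bx.
  rewrite big1 // => c _; case: (boolP (blocks _ _ _)) => [/blocks_size|_].
    by rewrite weight_cat bx => ew; rewrite ew ltnNge leq_addr in ltwx.
  by rewrite mulr0.
rewrite -(cat_take_drop x w); set U := take _ _; set w' := drop _ _.
have sU : size U = x by rewrite size_takel.
rewrite blocks_cons // -mulnb natrM -IH.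
have -> : (sorted r' U)%:R =
    \sum_(b <- comps x) csign b * (blocks r b U)%:R :> k.
  case: U sU => [|a U] sU; first by case: (x) sU => [[]].
  by rewrite -omega_row sU.
rewrite big_distrl /= big_seq [RHS]big_seq; apply: eq_bigr => b; rewrite mem_comps => /eqP bx.
rewrite big_distrr; apply: eq_bigr => c _.
by rewrite csign_cat blocks_cat ?bx // -mulnb natrM mulrACA.
Qed.

End Negation.
End Omega.

(** * Coefficients on the monomial basis *)

Lemma fsbig_seq_cond (R : Type) (idx : R) (op : Monoid.com_law idx)
    (T : choiceType) (A : set T) (s : seq T) (F : T -> R) :
    uniq s -> (forall x, A x -> x \in s) ->
  \big[op/idx]_(x \in A) F x = \big[op/idx]_(x <- s | `[< A x >]) F x.
Proof.
move=> us As; rewrite -[RHS]big_filter [RHS]fsbig_seq ?filter_uniq //; apply: eq_fsbigl.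
apply/seteqP; split=> x /=; rewrite mem_filter.
  by move=> Ax; rewrite As // andbT; apply/asboolP.
by case/andP => /asboolP.
Qed.

Lemma cset_cons x b i : cset (x :: b) i <->
  (b != [::] /\ i = x) \/ exists2 j, cset b j & i = (x + j)%N.
Proof.
split.
  case=> [[//|[|j]]] /= ltj ->.
    left; split; first by case: (b) ltj.
    by rewrite weight_cons take0 weight_nil addn0.
  by right; exists (weight (take j.+1 b)); [exists j.+1 | rewrite weight_cons].
case=> [[b0 ->]|[j [l /andP[l0 lb] ->] ->]].
  exists 1%N; first by case: (b) b0.
  by rewrite /= take0 weight_cons weight_nil addn0.
by exists l.+1 => //=; rewrite weight_cons.
Qed.

(** For the weak order these are the descents of [w], for the opposite strict
    order the ascents. *)
Definition breaks (r : rel posint) (w : word) : set nat :=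
  [set i | (0 < i < size w)%N /\ ~~ r (nth pone w i.-1) (nth pone w i)].

Lemma breaks_cat r U w b (x : posint) : size U = x -> size w = weight b ->
  breaks r (U ++ w) `<=` cset (x :: b) <->
  sorted r U /\ breaks r w `<=` cset b.
Proof.
move=> sU sw; split=> [sub|[srU sub] i [/andP[i0]]].
  split.
    apply/(sortedP pone) => i lti; apply: contraT => nr.
    have /sub/cset_cons : breaks r (U ++ w) i.+1.
      split; first by rewrite /= size_cat; lia.
      by rewrite !nth_cat lti /= (ltnW lti).
    by case=> [[_ ei]|[j _ ei]]; lia.
  move=> i [/andP[i0 lti] nr].
  have /sub/cset_cons : breaks r (U ++ w) (x + i)%N.
    split; first by rewrite size_cat; lia.
    rewrite !nth_cat sU !ifN -?leqNgt; [|lia|lia].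
    by rewrite addKn; have -> : ((x + i).-1 - x = i.-1)%N by lia.
  case=> [[_ ei]|[j cj ej]]; first by lia.
  by have -> : i = j by lia.
rewrite size_cat sU => lti nr; apply/cset_cons; case: (ltngtP i x) => [ltx|gtx|ex].
- move: nr; rewrite !nth_cat sU ltx ifT ?sU; last by lia.
  have := sortedP pone srU i.-1; rewrite sU prednK // => /(_ ltx).
  by move=> ->.
- right; exists (i - x)%N; last by lia.
  apply: sub; split; first by lia.
  move: nr; rewrite !nth_cat sU !ifN -?leqNgt; [|lia|lia].
  by have -> : (i.-1 - x = (i - x).-1)%N by lia.
- left; split=> //; apply/eqP => b0.
  by move: lti; rewrite sw b0 weight_nil ex addn0 ltnn.
Qed.

Lemma blocks_breaks r b w :
  blocks r b w = (weight b == size w) && `[< breaks r w `<=` cset b >].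
Proof.
elim: b w => [|x b IH] w.
  rewrite weight_nil /= -size_eq0 (eq_sym 0%N); case: eqP => //= w0; symmetry.
  by apply/asboolP => i []; rewrite w0 ltn0 andbF.
rewrite weight_cons; case: (ltnP (size w) x) => [ltx|lex].
  by rewrite /= leqNgt ltx /=; case: eqP => //; lia.
rewrite -(cat_take_drop x w); set U := take _ _; set w' := drop _ _.
have sU : size U = x by rewrite size_takel.
rewrite blocks_cons // IH size_cat sU eqn_add2l.
case: eqP => /= [ew|]; last by rewrite andbF.
apply/andP/asboolP => [[srU /asboolP sub]|/breaks_cat].
  by apply/breaks_cat.
by move=> /(_ sU (esym ew))[-> sub]; split=> //; apply/asboolP.
Qed.

Lemma breaks_sub r w : breaks r w `<=` [set i | (0 < i < size w)%N].
Proof. by move=> i []. Qed.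

Lemma Des_breaks w : Des w = breaks ple w.
Proof.
apply/seteqP; split=> i [/andP[i0 lti] d]; split; rewrite ?i0 //.
  rewrite -pgtE /pgt; move: d.
  by rewrite !(nth_map pone) //; apply: leq_ltn_trans lti; rewrite leq_pred.
rewrite !(nth_map pone) //; last by apply: leq_ltn_trans lti; rewrite leq_pred.
by move: d; rewrite -pgtE.
Qed.

Lemma descompP w :
  weight (descomp w) = size w /\ cset (descomp w) = breaks ple w.
Proof. by rewrite /descomp Des_breaks; apply: comp_ofP; apply: breaks_sub. Qed.

Lemma compl_descompP w : weight (compl (descomp w)) = size w /\
  cset (compl (descomp w)) = breaks pgt w.
Proof.
have [ew ec] := descompP w; rewrite /compl ew ec.
have -> : [set i | (0 < i < size w)%N /\ ~ breaks ple w i] = breaks pgt w.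
  apply/seteqP; split=> i [lti].
    by move=> nb; split=> //; apply/negP => d; apply: nb; split=> //; rewrite -pgtE.
  by rewrite pgtE negbK => d; split=> // -[_]; rewrite d.
by apply: comp_ofP; apply: breaks_sub.
Qed.

Section Coef.
Variable k : fieldType.

Lemma mcoeff_L a b :
  (L k a)@_b = ((weight b == weight a) && `[< cset a `<=` cset b >])%:R.
Proof.
rewrite /L (fsbig_seq_cond _ _ (uniq_comps (weight a))); last first.
  by move=> c [wc _]; rewrite mem_comps wc.
rewrite raddf_sum /=; under eq_bigr do rewrite mcoeffU.
rewrite -mem_comps; case: (boolP (b \in _)) => bn /=; last first.
  rewrite big_seq_cond big1 // => c /andP[cn _]; case: eqP => // ecb.
  by rewrite -ecb cn in bn.
rewrite big_mkcond (bigD1_seq b) ?uniq_comps //= eqxx mulr1n.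
rewrite big1 => [|c /negPf ->]; last by rewrite mulr0n if_same.
rewrite addr0; have := bn; rewrite mem_comps => /eqP wb; rewrite wb.
have -> : (weight a = weight a /\ cset a `<=` cset b) = (cset a `<=` cset b).
  by apply/propext; split=> [[]|].
by case: ifP.
Qed.

Lemma mcoeff_L_des w b : (L k (descomp w))@_b = (blocks ple b w)%:R.
Proof. by have [ew ec] := descompP w; rewrite mcoeff_L ew ec -blocks_breaks. Qed.

Lemma mcoeff_L_compl_des w b :
  (L k (compl (descomp w)))@_b = (blocks pgt b w)%:R.
Proof.
by have [ew ec] := compl_descompP w; rewrite mcoeff_L ew ec -blocks_breaks.
Qed.

Lemma linextw (B : choiceType) (V : lmodType k) (f : B -> V) x (d : {fset B}) :
    (msupp x `<=` d)%fset ->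
  linext f x = \sum_(b <- d) x@_b *: f b.
Proof.
move=> sub; rewrite /linext; apply: big_fset_incl => // b bd nb.
by rewrite (mcoeff_outdom nb) scale0r.
Qed.

Lemma linext_is_linear (B : choiceType) (V : lmodType k) (f : B -> V) :
  linear (linext f).
Proof.
move=> c x y; set d := (msupp x `|` msupp y)%fset.
rewrite !(@linextw _ _ _ _ d) ?fsubsetUl ?fsubsetUr //; last first.
  apply: fsubset_trans (msuppD_le _ _) _.
  by apply: fsetSU; apply: msuppZ_le.
rewrite scaler_sumr -big_split /=; apply: eq_bigr => b _.
by rewrite mcoeffD mcoeffZ scalerDl scalerA.
Qed.

HB.instance Definition _ (B : choiceType) (V : lmodType k) (f : B -> V) :=
  GRing.isLinear.Build k {malg k[B]} V *:%R (linext f) (linext_is_linear f).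

Lemma linextU (B : choiceType) (V : lmodType k) (f : B -> V) b :
  linext f << b >> = f b.
Proof.
rewrite (linextw f (_ : _ `<=` [fset b])%fset) ?msuppU_le //.
by rewrite big_seq_fset1 mcoeffU eqxx scale1r.
Qed.

HB.instance Definition _ :=
  GRing.Linear.copy (psi_le k) (linext (fun b => L k (descomp (wp_word b)))).
HB.instance Definition _ := GRing.Linear.copy (psi_gt k)
  (linext (fun b => L k (compl (descomp (wp_word b))))).

End Coef.

(** * Class sums and their images *)

Section Span.
Variables (k : fieldType) (V : lmodType k).
Implicit Types (S P : set V).

Definition lin_closed P := P 0 /\ forall c f g, P f -> P g -> P (c *: f + g).

Lemma lin_closed_sum P (I : Type) (r : seq I) (C : pred I) (F : I -> V) :
  lin_closed P -> (forall i, C i -> P (F i)) -> P (\sum_(i <- r | C i) F i).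
Proof.
case=> P0 PD PF; elim/big_ind: _ => // x y Px Py.
by rewrite -[x]scale1r; apply: PD.
Qed.

Lemma lin_closedZ P c f : lin_closed P -> P f -> P (c *: f).
Proof. by case=> P0 PD Pf; rewrite -[_ *: _]addr0; apply: PD. Qed.

Lemma lin_closedB P f g : lin_closed P -> P f -> P g -> P (f - g).
Proof. by case=> P0 PD Pf Pg; rewrite addrC -scaleN1r; apply: PD. Qed.

Lemma subset_span S : S `<=` Defs.span S.
Proof.
move=> x Sx; exists 1%N, (fun=> 1), (fun=> x); split=> //.
by rewrite big_ord1 scale1r.
Qed.

Lemma span_sub S P : lin_closed P -> S `<=` P -> Defs.span S `<=` P.
Proof.
move=> linP SP _ [n [c [v [Sv ->]]]]; apply: lin_closed_sum => // i _.
by apply: lin_closedZ => //; apply: SP.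
Qed.

Lemma span_lin_closed S : lin_closed (Defs.span S).
Proof.
split=> [|a _ _ [n [c [v [Sv ->]]]] [p [d [w [Sw ->]]]]].
  by exists 0%N, (fun=> 0), (fun=> 0); split=> [[]|]; rewrite ?big_ord0.
exists (n + p)%N, (fun i => match split i with inl j => a * c j | inr j => d j end).
exists (fun i => match split i with inl j => v j | inr j => w j end); split.
  by move=> i; case: (split i).
rewrite big_split_ord /= scaler_sumr; congr (_ + _); apply: eq_bigr => i _.
  by rewrite (unsplitK (inl i)) scalerA.
by rewrite (unsplitK (inr i)).
Qed.

End Span.

Lemma lin_closed_image (k : fieldType) (U V : lmodType k) (f : {linear U -> V})
  (S : set U) : lin_closed S -> lin_closed (f @` S).
Proof.
case=> S0 SD; split; first by exists 0; rewrite ?linear0.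
by move=> c _ _ [x Sx <-] [y Sy <-]; exists (c *: x + y); [apply: SD|rewrite linearP].
Qed.

Section Psi.
Variable k : fieldType.

Definition coef (f : {malg k[compn]}) : compn -> k := fun a => f@_a.

Lemma coef_psi_le x g : (psi_le k x)@_g =
  \sum_(b <- msupp x) x@_b * (blocks ple g (wp_word b))%:R.
Proof.
rewrite raddf_sum /=; apply: eq_bigr => b _.
by rewrite mcoeffZ mcoeff_L_des.
Qed.

Lemma coef_psi_gt x g : (psi_gt k x)@_g =
  \sum_(b <- msupp x) x@_b * (blocks pgt g (wp_word b))%:R.
Proof.
rewrite raddf_sum /=; apply: eq_bigr => b _.
by rewrite mcoeffZ mcoeff_L_compl_des.
Qed.

Lemma omega_sum (I : Type) (s : seq I) (c : I -> k) (F : I -> compn -> k) g :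
  omega (fun b => \sum_(i <- s) c i * F i b) g = \sum_(i <- s) c i * omega (F i) g.
Proof.
rewrite /omega; under eq_bigr do rewrite mulr_sumr.
rewrite exchange_big; apply: eq_bigr => i _; rewrite mulr_sumr.
by apply: eq_bigr => b _; rewrite mulrCA.
Qed.

Lemma eq_omega (F G : compn -> k) g : F =1 G -> omega F g = omega G g.
Proof. by move=> FG; apply: eq_bigr => b _; rewrite FG. Qed.

Lemma psi_gt_omega x g : (psi_gt k x)@_g = omega (coef (psi_le k x)) g.
Proof.
rewrite (eq_omega _ (coef_psi_le x)) omega_sum coef_psi_gt.
by apply: eq_bigr => b _; rewrite (omega_blocks _ pgtE).
Qed.

Lemma psi_le_omega x g : (psi_le k x)@_g = omega (coef (psi_gt k x)) g.
Proof.
rewrite (eq_omega _ (coef_psi_gt x)) omega_sum coef_psi_le.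
apply: eq_bigr => b _; rewrite (@omega_blocks k pgt ple) // => a c.
by rewrite pgtE negbK.
Qed.

Lemma csym_psi_gt x : csym (coef (psi_le k x)) -> csym (coef (psi_gt k x)).
Proof. by move=> /csym_omega sx a b pab; rewrite /coef !psi_gt_omega (sx a b). Qed.

Lemma csym_psi_le x : csym (coef (psi_gt k x)) -> csym (coef (psi_le k x)).
Proof. by move=> /csym_omega sx a b pab; rewrite /coef !psi_le_omega (sx a b). Qed.

(** This set is Sym, by [SymE]. *)
Definition csymset : set {malg k[compn]} := [set f | csym (coef f)].

Lemma csymset_lin_closed : lin_closed csymset.
Proof.
split=> [a b _|c f g sf sg a b pab]; first by rewrite /coef !mcoeff0.
by rewrite /coef !mcoeffD !mcoeffZ; congr (_ * _ + _); [apply: sf | apply: sg].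
Qed.

End Psi.

Section Relation.
Variables (k : fieldType) (sim : word -> word -> Prop).
Hypotheses (sim_wrel : word_relation sim) (sim_hom : homogeneous sim).
Hypothesis sim_ualg : uniformly_algebraic sim.

Let simP u v : bool := `[< sim u v >].

(** Restriction to a single letter counts its occurrences, because the relation
    is homogeneous. *)
Lemma sim_perm u v : sim u v -> perm_eq u v.
Proof.
move=> uv; apply/allP => a _ /=; apply/eqP.
have cons_a : consecutive (pred1 a).
  move=> x y z /eqP-> /eqP-> /andP[le1 le2]; apply/eqP/val_inj.
  by apply/eqP; rewrite eqn_leq le1 le2.
by have := sim_hom (ualg_restrict sim_ualg cons_a uv); rewrite !size_filter.
Qed.

Lemma maxw_perm u v : perm_eq u v -> maxw u = maxw v.
Proof. exact: perm_big. Qed.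

Lemma maxw_nil : (maxw ([::] : word, 0%N).1 <= ([::] : word, 0%N).2)%N.
Proof. by rewrite /maxw big_nil. Qed.

(** The basis vector [[w, n]]; a junk value when [w] has a letter above [n]. *)
Definition wp n (w : word) : wpair := insubd (WPair maxw_nil) (w, n).

Lemma wpK n w : (maxw w <= n)%N -> wpair_val (wp n w) = (w, n).
Proof. by move=> le; rewrite (val_insubd (WPair maxw_nil) (w, n)) /= le. Qed.

Lemma wp_wordK n w : (maxw w <= n)%N -> wp_word (wp n w) = w.
Proof. by move=> le; rewrite /wp_word wpK. Qed.

Lemma kappaE n u : (maxw u <= n)%N ->
  kappa k n [set v | sim u v] =
  \sum_(w <- permutations u | simP u w) << wp n w >>.
Proof.
move=> le; have lep w : w \in permutations u -> (maxw w <= n)%N.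
  by rewrite mem_permutations => /maxw_perm ->.
rewrite /kappa (fsbig_seq_cond _ _ (s := map (wp n) (permutations u))).
- rewrite big_map big_seq_cond [RHS]big_seq_cond; apply: eq_bigl => w.
  case: (boolP (w \in _)) => //= wp; rewrite /wp_n /wp_word wpK ?lep //=.
  by apply/asboolP/asboolP => [[]|].
- rewrite map_inj_in_uniq ?permutations_uniq // => v w vu wu e.
  by have := wpK (lep v vu); rewrite e wpK ?lep // => -[].
case=> -[w m] lem [/= em]; rewrite /wp_word /= in em * => uw.
apply/mapP; exists w.
  by rewrite mem_permutations perm_sym sim_perm.
have <- : m = n by [].
by apply: val_inj; rewrite /= val_insubd /= lem.
Qed.

Lemma coef_kappa n u g : (maxw u <= n)%N ->
  (psi_le k (kappa k n [set v | sim u v]))@_g =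
  (count (fun w => simP u w && blocks ple g w) (permutations u))%:R.
Proof.
move=> le; rewrite kappaE // (raddf_sum (psi_le k)) raddf_sum.
rewrite -sum1_count natr_sum [RHS]big_mkcondr /=.
rewrite big_seq_cond [RHS]big_seq_cond; apply: eq_bigr => w /andP[wu _].
rewrite /psi_le linextU mcoeff_L_des wp_wordK; first by case: (blocks _ _ _).
by move: wu; rewrite mem_permutations => /maxw_perm ->.
Qed.

Lemma Kspace_kappa n u : (maxw u <= n)%N ->
  Kspace k sim (kappa k n [set v | sim u v]).
Proof.
by move=> le; apply: subset_span; exists n, [set v | sim u v]; split=> //; exists u.
Qed.

Lemma Kspace_lin_closed : lin_closed (Kspace k sim).
Proof. exact: span_lin_closed. Qed.

(** Classes are finite and disjoint, so they can be split off one at a time. *)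
Lemma Kspace_saturated n (s : seq word) : uniq s ->
    (forall w, w \in s -> (maxw w <= n)%N) ->
    (forall v w, v \in s -> sim v w -> w \in s) ->
  Kspace k sim (\sum_(w <- s) << wp n w >>).
Proof.
have [m] := ubnP (size s); elim: m s => // m IH s; rewrite ltnS => lem us les sat.
have [->|[u us_u]] : s = [::] \/ exists u, u \in s.
- by case: (s) => [|u s']; [left | right; exists u; apply: mem_head].
- by rewrite big_nil; case: Kspace_lin_closed.
have refl_u : simP u u by apply/asboolP; apply: wrel_refl.
rewrite (bigID (simP u)) /=.
rewrite -[X in X + _]scale1r; case: Kspace_lin_closed => _; apply.
  rewrite -big_filter.
  rewrite (perm_big [seq w <- permutations u | simP u w]) /=.
    by rewrite big_filter -kappaE; [apply: Kspace_kappa | ]; apply: les.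
  apply: uniq_perm; rewrite ?filter_uniq ?permutations_uniq // => w.
  rewrite !mem_filter mem_permutations; case: (boolP (simP u w)) => //= /asboolP uw.
  by rewrite (sat u w us_u uw) perm_sym sim_perm.
rewrite -big_filter; apply: IH.
- apply: leq_trans lem; rewrite size_filter -(count_predC (simP u) s).
  by rewrite -add1n leq_add2r -has_count; apply/hasP; exists u.
- exact: filter_uniq.
- by move=> w; rewrite mem_filter => /andP[_ /les].
move=> v w; rewrite !mem_filter => /andP[nuv vs] vw.
rewrite (sat v) // andbT; apply/asboolP => uw; move/asboolP: nuv; apply.
by apply: (wrel_trans sim_wrel) uw _; apply: (wrel_sym sim_wrel).
Qed.

Lemma Kspace_content n u : (maxw u <= n)%N ->
  Kspace k sim (\sum_(w <- permutations u) << wp n w >>).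
Proof.
move=> le; apply: Kspace_saturated => [|w|v w]; first exact: permutations_uniq.
  by rewrite mem_permutations => /maxw_perm ->.
rewrite !mem_permutations => vu /sim_perm vw.
by apply: perm_trans vu; rewrite perm_sym.
Qed.

Lemma coef_psi_gt_content n u g : (maxw u <= n)%N ->
  (psi_gt k (\sum_(w <- permutations u) << wp n w >>))@_g =
  (count (blocks pgt g) (permutations u))%:R.
Proof.
move=> le; rewrite (raddf_sum (psi_gt k)) raddf_sum -sum1_count natr_sum [RHS]big_mkcond.
rewrite big_seq [RHS]big_seq; apply: eq_bigr => w wu.
rewrite /= /psi_gt linextU mcoeff_L_compl_des wp_wordK; first by case: (blocks _ _ _).
by move: wu; rewrite mem_permutations => /maxw_perm ->.
Qed.

(** * Symmetry and Knuth equivalence *)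

Lemma csym_of_knuth : extends sim knuth ->
  psi_le k @` Kspace k sim `<=` @csymset k.
Proof.
move=> ext _ [x Kx <-]; move: x Kx.
apply: (span_sub (P := [set x | csymset (psi_le k x)])).
  have [s0 sD] := csymset_lin_closed k.
  by split=> [|c f g /= sf sg] /=; rewrite ?linear0 // linearP; apply: sD.
move=> _ [n [_ [[u le ->] ->]]] /=.
apply: adjacent_swaps_perm => a x y b; rewrite /coef !coef_kappa //.
congr _%:R; apply: count_blocks_knuth => v w /ext vw.
apply/asboolP/asboolP => uv; first exact: (wrel_trans sim_wrel) uv vw.
by apply: (wrel_trans sim_wrel) uv _; apply: (wrel_sym sim_wrel).
Qed.

End Relation.

Lemma perm2 (x y : posint) w : perm_eq w [:: x; y] -> w = [:: x; y] \/ w = [:: y; x].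
Proof.
case: w => [|a w] p; first by move/perm_size: p.
have : a \in [:: x; y] by rewrite -(perm_mem p) mem_head.
rewrite !inE => /orP[]/eqP ea; move: p; rewrite ea.
  by rewrite perm_cons => /perm_small_eq -> //; left.
rewrite perm_sym (perm_catC [:: x] [:: y]) perm_sym /= perm_cons.
by move=> /perm_small_eq -> //; right.
Qed.

Definition arrangements (x y z : posint) : seq word :=
  [:: [:: x; y; z]; [:: x; z; y]; [:: y; x; z]; [:: y; z; x];
      [:: z; x; y]; [:: z; y; x]].

Lemma perm3 (x y z : posint) w : perm_eq w [:: x; y; z] ->
  w \in arrangements x y z.
Proof.
case: w => [|a w] p; first by move/perm_size: p.
have : a \in [:: x; y; z] by rewrite -(perm_mem p) mem_head.
rewrite !inE => /or3P[]/eqP ea; move: p; rewrite ea.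
- by rewrite perm_cons => /perm2[] ->; rewrite eqxx ?orbT.
- rewrite perm_sym (perm_catCA [:: x] [:: y]) perm_sym /= perm_cons.
  by move=> /perm2[] ->; rewrite eqxx ?orbT.
rewrite perm_sym (perm_catC [:: x; y] [:: z]) perm_sym /= perm_cons.
by move=> /perm2[] ->; rewrite eqxx ?orbT.
Qed.

Definition ptwo : posint := psucc pone.

Lemma count_exchange (T : eqType) (s : seq T) (p q : pred T) :
    count p s = count q s -> has (predD p q) s -> has (predD q p) s.
Proof.
rewrite -!size_filter => e; rewrite !has_count => lt.
have c1 (p' q' : pred T) :
    size (filter p' s) = (count (predI p' q') s + count (predD p' q') s)%N.
  rewrite -(count_predC q' (filter p' s)) !count_filter.
  by congr (_ + _)%N; apply: eq_count => z /=; rewrite 1?andbC.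
move: e; rewrite (c1 p q) (c1 q p).
have -> : count (predI p q) s = count (predI q p) s.
  by apply: eq_count => z /=; rewrite andbC.
by move/addnI => <-.
Qed.

Lemma natr_inj_char0 (k : fieldType) : [pchar k] =i pred0 ->
  injective (fun n => n%:R : k).
Proof.
move=> /pcharf0P char0 m n; wlog lemn : m n / (m <= n)%N.
  by move=> H e; case/orP: (leq_total m n) => l; [apply: H | apply/esym/H].
move=> /eqP; rewrite eq_sym -subr_eq0 -natrB // char0 subn_eq0 => lenm.
by apply/eqP; rewrite eqn_leq lemn.
Qed.

Section KnuthNecessary.
Variables (k : fieldType) (sim : word -> word -> Prop).
Hypotheses (char0 : [pchar k] =i pred0).
Hypotheses (sim_wrel : word_relation sim) (sim_hom : homogeneous sim).
Hypothesis sim_ualg : uniformly_algebraic sim.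
Hypothesis K_sym : psi_le k @` Kspace k sim `<=` @csymset k.

(** The coefficients at [M_(1,2)] and at [M_(2,1)] agree, and the words that
    contribute to both of them cancel: a class of words of length 3 has as many
    members with descent set [{1}] as with descent set [{2}].  Characteristic
    zero turns the equality of coefficients into one of cardinalities. *)
Lemma descent_exchange (x y z : posint) (p q : compn) :
    perm_eq p q -> let D p q := predD (blocks ple p) (blocks ple q) in
    D p q [:: x; y; z] ->
  exists w, [/\ sim [:: x; y; z] w, D q p w & perm_eq w [:: x; y; z]].
Proof.
move=> pq D Du; set u := [:: x; y; z] in Du *.
have /K_sym symK : (psi_le k @` Kspace k sim)
    (psi_le k (kappa k (maxw u) [set v | sim u v])).
  by apply: imageP; apply: Kspace_kappa.
have := symK _ _ pq; rewrite /coef !coef_kappa // => /(natr_inj_char0 char0) e.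
have uu : `[< sim u u >] by apply/asboolP/(wrel_refl sim_wrel).
have /(count_exchange e)/hasP[w] : has (predD (fun w => `[< sim u w >] && blocks ple p w)
    (fun w => `[< sim u w >] && blocks ple q w)) (permutations u).
  apply/hasP; exists u; first by rewrite mem_permutations.
  by move: Du; rewrite /D /= uu /= => /andP[-> ->].
rewrite mem_permutations => wu /= /andP[np /andP[/asboolP uw qw]].
exists w; split=> //; rewrite /D /= qw andbT.
by move: np; rewrite (introT (asboolP _) uw).
Qed.

Lemma peak_of_valley (x y z : posint) : pgt x y -> ple y z ->
  exists x' y' z', [/\ sim [:: x; y; z] [:: x'; y'; z'],
    ple x' y' && pgt y' z' & [:: x'; y'; z'] \in arrangements x y z].
Proof.
move=> xy yz; have [] := @descent_exchange x y z [:: pone; ptwo] [:: ptwo; pone] isT.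
  by rewrite /= !andbT yz -pgtE xy.
move=> w [uw Dw pw]; have := perm_size pw.
case: w uw Dw pw => [|x' [|y' [|z' [|t w]]]] // uw Dw pw _.
exists x', y', z'; split=> //; last exact: perm3.
by move: Dw; rewrite /= !andbT pgtE andbC.
Qed.

Lemma valley_of_peak (x y z : posint) : ple x y -> pgt y z ->
  exists x' y' z', [/\ sim [:: x; y; z] [:: x'; y'; z'],
    pgt x' y' && ple y' z' & [:: x'; y'; z'] \in arrangements x y z].
Proof.
move=> xy yz; have [] := @descent_exchange x y z [:: ptwo; pone] [:: pone; ptwo] isT.
  by rewrite /= !andbT xy -pgtE yz.
move=> w [uw Dw pw]; have := perm_size pw.
case: w uw Dw pw => [|x' [|y' [|z' [|t w]]]] // uw Dw pw _.
exists x', y', z'; split=> //; last exact: perm3.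
by move: Dw; rewrite /= !andbT pgtE.
Qed.

(** Order-preserving injections of the interval from [a] to [b] can stretch it,
    but not shrink it. *)
Lemma sim_swap_widen (a b c : posint) : (a < b < c)%N ->
  sim [:: b; a] [:: a; b] -> sim [:: c; a] [:: a; c].
Proof.
move=> /andP[ab bc] ba.
have phi_gt0 (x : posint) : (0 < if (x < b)%N then x : nat else (x + (c - b)))%N.
  by case: x => x x0 /=; case: ifP => // _; rewrite addn_gt0 x0.
pose phi (x : posint) := PosInt (phi_gt0 x).
have phia : phi a = a by apply: val_inj; rewrite /= ab.
have phib : phi b = c by apply: val_inj; rewrite /= ltnn subnKC // ltnW.
have := ualg_map sim_ualg (phi := phi) _ _ ba; rewrite /= phia phib; apply.
  move=> x y _ _ [] /eqP; case: ifP => ?; case: ifP => ? /eqP ?; apply: val_inj => /=; lia.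
by move=> x y _ _ /=; case: ifP; case: ifP; lia.
Qed.

Lemma sim_restrict (a b : posint) v w : sim v w ->
  sim [seq x : posint <- v | (a <= x <= b)%N] [seq x : posint <- w | (a <= x <= b)%N].
Proof.
move=> vw; apply: (ualg_restrict sim_ualg (I := [pred x : posint | (a <= x <= b)%N])) => //.
by move=> x y z /= ; lia.
Qed.

(** The class of [bac] has a second word with the other descent set, [bca] or
    [acb].  In the second case restriction to the letters from [a] to [b] gives
    [ba ~ ab]; this widens to [ca ~ ac], whence [bac ~ bca] again.  The relation
    [acb ~ cab] is similar, and for words with a repeated letter there is only
    one candidate. *)
Lemma knuth_of_csym : extends sim knuth.
Proof.
have pq12 : perm_eq [:: pone; ptwo] [:: ptwo; pone] by [].
have pq21 : perm_eq [:: ptwo; pone] [:: pone; ptwo] by [].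
have symm := wrel_sym sim_wrel; have refl := wrel_refl sim_wrel.
move=> v w; elim=> {v w} [v|v w _|u v w _ uv _|v v' w w' _ + _|a b c|a b c|a b ab|a b ab].
- exact: (wrel_refl sim_wrel).
- exact: symm.
- exact: (wrel_trans sim_wrel).
- exact: (ualg_cat sim_ualg).
- move=> abc; have := abc => /andP[ab bc].
  have [||x [y [z [uw D]]]] := @peak_of_valley b a c; rewrite /pgt /ple //.
    exact: ltnW (ltn_trans ab bc).
  rewrite !inE => /or4P[|||/or3P[]] /eqP[ex ey ez]; move: D uw;
    rewrite ex ey ez /pgt /ple; try lia; move=> _ //.
  move/(sim_restrict a b); rewrite /= !leqnn (ltnW ab) (leqNgt c) bc andbF.
  move=> /(sim_swap_widen abc) ca.
  exact: symm (ualg_cat sim_ualg (refl [:: b]) ca).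
- move=> abc; have := abc => /andP[ab bc].
  have [||x [y [z [uw D]]]] := @valley_of_peak a c b; rewrite /pgt /ple //.
    exact: ltnW (ltn_trans ab bc).
  rewrite !inE => /or4P[|||/or3P[]] /eqP[ex ey ez]; move: D uw;
    rewrite ex ey ez /pgt /ple; try lia; move=> _ //.
  move/(sim_restrict a b); rewrite /= !leqnn (ltnW ab) (leqNgt c) bc andbF.
  move=> /symm/(sim_swap_widen abc) ca.
  exact: symm (ualg_cat sim_ualg ca (refl [:: b])).
- have [||x [y [z [uw D]]]] := @valley_of_peak a b a; rewrite /pgt /ple ?(ltnW ab) //.
  rewrite !inE => /or4P[|||/or3P[]] /eqP[ex ey ez]; move: D uw;
    by rewrite ex ey ez /pgt /ple //; lia.
have [||x [y [z [uw D]]]] := @peak_of_valley b a b; rewrite /pgt /ple ?(ltnW ab) //.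
rewrite !inE => /or4P[|||/or3P[]] /eqP[ex ey ez]; move: D uw;
    by rewrite ex ey ez /pgt /ple //; lia.
Qed.
End KnuthNecessary.

(** * Elementary symmetric functions span *)

Fixpoint col n : word := if n is n'.+1 then PosInt (ltn0Sn n') :: col n' else [::].

(** For a partition [l], the letter [i] occurs in [stair l] as often as the
    conjugate partition says: this is the content of [e_l]. *)
Fixpoint stair (l : compn) : word := if l is x :: l' then col x ++ stair l' else [::].

Lemma size_col n : size (col n) = n.
Proof. by elim: n => //= n ->. Qed.

Lemma mem_col n (a : posint) : (a \in col n) = (a <= n)%N.
Proof.
elim: n => [|n IH] /=; first by case: a => -[].
by rewrite inE IH [RHS]leq_eqVlt ltnS -val_eqE.
Qed.

Lemma sorted_col n : sorted pgt (col n).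
Proof.
case: n => //= n; elim: n => //= n ->; by rewrite /pgt /= ltnSn.
Qed.

Lemma size_stair l : size (stair l) = weight l.
Proof.
elim: l => [|x l IH] /=; first by rewrite weight_nil.
by rewrite weight_cons size_cat size_col IH.
Qed.

Lemma blocks_stair l : blocks pgt l (stair l).
Proof.
by elim: l => [|x l IH] //; rewrite [stair _]/= blocks_cons ?size_col // sorted_col.
Qed.

Lemma pgt_trans : transitive pgt.
Proof. by move=> y x z xy yz; apply: ltn_trans yz xy. Qed.

Lemma pgt_irr : irreflexive pgt.
Proof. by move=> x; rewrite /pgt ltnn. Qed.

Definition pge : rel posint := fun x y => (y <= x)%N.

Lemma mem_stair l x : sorted pge (x :: l) -> forall a, a \in stair (x :: l) -> (a <= x)%N.
Proof.
elim: l x => [|y l IH] x; first by move=> _ a; rewrite /= cats0 mem_col.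
move=> /= /andP[xy sl] a; rewrite mem_cat mem_col => /orP[//|aS].
by apply: leq_trans xy; apply: (IH y sl).
Qed.

(** Base [B] digits, the first part being the most significant: on compositions
    with parts below [B] and at most [d] parts, this is the lexicographic order. *)
Fixpoint code (B d : nat) (b : compn) : nat :=
  match d, b with
  | d'.+1, x :: b' => (x * B ^ d' + code B d' b')%N
  | _, _ => 0%N
  end.

Lemma code_bound B d b : (0 < B)%N -> all (fun x : posint => (x < B)%N) b ->
  (code B d b < B ^ d)%N.
Proof.
move=> B0; elim: d b => [|d IH] [|x b] //=; rewrite ?expn_gt0 ?B0 //.
move=> /andP[xB /IH lt]; apply: (@leq_trans (x.+1 * B ^ d)).
  by rewrite mulSn addnC ltn_add2r.
by rewrite expnS leq_mul2r xB orbT.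
Qed.

Lemma part_le_weight b (x : posint) : x \in b -> (x <= weight b)%N.
Proof.
elim: b => // y b IH; rewrite inE weight_cons => /orP[/eqP->|/IH le].
  exact: leq_addr.
exact: leq_trans le (leq_addl _ _).
Qed.

Lemma parts_lt B b : (weight b < B)%N -> all (fun x : posint => (x < B)%N) b.
Proof. by move=> lt; apply/allP => x /part_le_weight le; apply: leq_ltn_trans lt. Qed.

Lemma size_le_weight b : (size b <= weight b)%N.
Proof.
elim: b => // x b IH; rewrite weight_cons /= -add1n leq_add //; by case: x.
Qed.

(** So a composition with largest [code] among its rearrangements is a
    partition. *)
Lemma code_swap B a (x y : posint) b d : (x < y)%N ->
    (weight (a ++ x :: y :: b) < B)%N -> (size (a ++ x :: y :: b) <= d)%N ->
  (code B d (a ++ x :: y :: b) < code B d (a ++ y :: x :: b))%N.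
Proof.
move=> xy; elim: a d => [|z a IH] [|d] //=; rewrite !weight_cons => wB ltd.
  apply: (@leq_trans (x.+1 * B ^ d)); last first.
    by apply: leq_trans (leq_addr _ _); rewrite leq_mul2r xy orbT.
  rewrite mulSn addnC ltn_add2r; apply: code_bound; first by lia.
  by apply: parts_lt; rewrite weight_cons; lia.
by rewrite ltn_add2l; apply: IH => //; lia.
Qed.

(** The letters of [stair l] are at most the first part [x] of [l].  Hence a
    strictly decreasing first block has at most [x] letters, and if it has
    exactly [x] letters it is [col x] and can be removed. *)
Lemma stair_code B d l b w : sorted pge l -> (weight l < B)%N -> (size l <= d)%N ->
    perm_eq w (stair l) -> blocks pgt b w ->
  (code B d b < code B d l)%N \/ b = l /\ w = stair l.
Proof.
elim: l d b w => [|x l IH] [|d] b w //.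
- move=> _ _ _ /perm_nilP ->; case: b => [|y b]; first by right.
  by move=> /blocks_size; rewrite weight_cons /=; case: y => -[].
- move=> _ _ _ /perm_nilP ->; case: b => [|y b]; first by right.
  by move=> /blocks_size; rewrite weight_cons /=; case: y => -[].
move=> sl wB ltd pw bw; have := blocks_size bw.
have := perm_size pw; rewrite size_stair => -> wb.
move: wB; rewrite weight_cons => wB; case: b bw wb => [|y b].
  by rewrite weight_nil weight_cons; case: (x) => -[].
move=> bw wb; move: bw pw; rewrite !weight_cons in wb.
rewrite -(cat_take_drop y w); set U := take _ _; set w' := drop _ _ => bw pw.
have sU : size U = y 
  by rewrite size_takel //; case/and3P: bw => [+ _ _]; rewrite cat_take_drop.
move: bw; rewrite blocks_cons // => /andP[srU bw'].
have uU : uniq U by apply: sorted_uniq srU; [apply: pgt_trans | apply: pgt_irr].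
have subU : {subset U <= col x}.
  move=> a aU; rewrite mem_col; apply: (mem_stair sl).
  by rewrite -(perm_mem pw) mem_cat aU.
have leyx : (y <= x)%N by rewrite -sU -(size_col x) uniq_leq_size.
case: (ltngtP y x) leyx => // [ltyx|eyx] _.
  left; rewrite /=; apply: leq_trans (leq_addr _ _).
  apply: (@leq_trans (y.+1 * B ^ d)); last by rewrite leq_mul2r ltyx orbT.
  rewrite mulSn addnC ltn_add2r; apply: code_bound; first by lia.
  by apply: parts_lt; lia.
have {}eyx : y = x by apply: val_inj.
have eU : U = col x.
  apply: (irr_sorted_eq pgt_trans pgt_irr) => //; first exact: sorted_col.
  apply: (uniq_min_size uU subU _).2; by rewrite size_col sU eyx.
move: pw; rewrite eU /= perm_cat2l => pw'.
have [|lt|[-> ->]] := IH d b w' (path_sorted sl) _ ltd pw' bw'; first by lia.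
  by left; rewrite /= eyx ltn_add2l.
by right; rewrite eyx.
Qed.

Section ElementarySpan.
Variables (k : fieldType) (A : set {malg k[compn]}).
Hypothesis A_lin : lin_closed A.
Hypothesis A_content : forall u : word, exists2 e, A e &
  forall g, e@_g = (count (blocks pgt g) (permutations u))%:R.

Lemma csym_content e u :
  (forall g, e@_g = (count (blocks pgt g) (permutations u))%:R) ->
  csymset (e : {malg k[compn]}).
Proof.
by move=> eE; apply: adjacent_swaps_perm => a x y b; rewrite /coef !eE count_blocks_swap.
Qed.

Lemma elementary B l : sorted pge l -> (weight l < B)%N ->
  exists e, [/\ A e, csymset e, e@_l = 1 &
    forall g, e@_g != 0 -> g = l \/ (weight g < B)%N && (code B B g < code B B l)%N].
Proof.
move=> sl lB; have [e Ae eE] := A_content (stair l).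
have lel : (size l <= B)%N by apply: leq_trans (size_le_weight l) (ltnW lB).
exists e; split=> //; first exact: csym_content eE.
  rewrite eE -[RHS]/1%:R; congr _%:R.
  rewrite (eq_in_count (a2 := pred1 (stair l))).
    by rewrite count_uniq_mem ?permutations_uniq // mem_permutations perm_refl.
  move=> w; rewrite mem_permutations => pw /=; apply/idP/eqP => [bw|->].
    by have [|[]] // := stair_code sl lB lel pw bw; rewrite ltnn.
  exact: blocks_stair.
move=> g; rewrite eE; case: (boolP (has (blocks pgt g) (permutations (stair l)))).
  move=> /hasP[w]; rewrite mem_permutations => pw bw _.
  have := stair_code sl lB lel pw bw; case=> [lt|[-> _]]; last by left.
  by right; rewrite lt andbT -(blocks_size bw) (perm_size pw) size_stair.
by rewrite has_count -eqn0Ngt => /eqP ->; rewrite eqxx.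
Qed.

(** By symmetry the compositions with largest [code] in the support of [f] are
    partitions, and subtracting multiples of the corresponding products of
    elementary symmetric functions clears their coefficients. *)
Lemma csym_sub_span B n (f : {malg k[compn]}) : csymset f ->
    (forall g, f@_g != 0 -> (weight g < B)%N && (code B B g < n)%N) -> A f.
Proof.
elim: n f => [|n IH] f symf supp.
  suff -> : f = 0 by case: A_lin.
  apply/malgP => g; rewrite mcoeff0; apply/eqP; apply: contraT => /supp.
  by rewrite ltn0 andbF.
have sorted_top l : f@_l != 0 -> code B B l = n -> sorted pge l.
  move=> fl cl; apply: contraT => nsl.
  have [a [x [y [b [el xy]]]]] : exists a x y b, l = a ++ x :: y :: b /\ (x < y)%N.
    elim: l nsl {fl cl} => [//|x [//|y l] IHl] /=; rewrite negb_and => /orP[nxy|].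
      by exists [::], x, y, l; rewrite ltnNge.
    by move=> /IHl[a [x' [y' [b [-> lt]]]]]; exists (x :: a), x', y', b.
  have fl' : f@_(a ++ y :: x :: b) != 0.
    rewrite -[f@__]/(coef f _) (symf _ l) // el perm_cat2l.
    by rewrite (perm_catCA [:: y] [:: x]).
  have /andP[wl _] := supp _ fl; have /andP[_] := supp _ fl'.
  rewrite ltnS leqNgt -cl el code_swap // -?el //.
  exact: leq_trans (size_le_weight l) (ltnW wl).
pose top := [seq l <- msupp f | code B B l == n].
pose R l e := [/\ A e, csymset e, e@_l = 1 &
    forall g, e@_g != 0 -> g = l \/ (weight g < B)%N && (code B B g < code B B l)%N].
have /choice[E ER] : forall l, exists e, l \in top -> R l e.
  move=> l; case: (boolP (l \in top)) => [|_]; last by exists 0.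
  rewrite mem_filter => /andP[/eqP cl]; rewrite -mcoeff_neq0 => fl.
  have /andP[wl _] := supp _ fl.
  by have [e] := elementary (sorted_top l fl cl) wl; exists e.
pose t := \sum_(l <- top) f@_l *: E l.
have At : A t.
  rewrite /t big_seq; apply: lin_closed_sum => // l /ER[Ae _ _ _].
  exact: lin_closedZ.
have symt : csymset t.
  rewrite /t big_seq; apply: lin_closed_sum => [|l /ER[_ se _ _]].
    exact: csymset_lin_closed.
  exact: (lin_closedZ _ (csymset_lin_closed k) se).
have tE g : t@_g = \sum_(l <- top) f@_l * (E l)@_g.
  by rewrite /t raddf_sum; apply: eq_bigr => l _; rewrite /= mcoeffZ.
have utop : uniq top by apply/filter_uniq/fset_uniq.
suff Aft : A (f - t) by rewrite -(subrK t f) -[f - t]scale1r; case: A_lin => _; apply.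
apply: IH => [|g].
  exact: (lin_closedB (csymset_lin_closed k) symf symt).
rewrite mcoeffB tE => ng.
have low : (code B B g < n)%N -> (weight g < B)%N -> (weight g < B)%N && (code B B g < n)%N.
  by move=> -> ->.
have [fg|fg] := eqVneq f@_g 0; last have /andP[wg] := supp g fg.
  have [l ltop] : exists2 l, l \in top & (E l)@_g != 0.
    apply/hasP; apply: contraNT ng => /hasPn z.
    rewrite fg sub0r oppr_eq0 big_seq big1 // => l /z; rewrite negbK => /eqP ->.
    by rewrite mulr0.
  have [_ _ _ /[apply]] := ER l ltop; case=> [egl|/andP[-> lt]].
    by move: ltop; rewrite mem_filter -egl -mcoeff_neq0 fg eqxx andbF.
  by move: ltop; rewrite mem_filter => /andP[/eqP <- _].
rewrite ltnS leq_eqVlt => /orP[/eqP cg|]; last by rewrite wg => ->.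
have gtop : g \in top.
  by rewrite mem_filter cg eqxx -mcoeff_neq0.
case/negP: ng; rewrite (bigD1_seq g) //=; have [_ _ -> _] := ER g gtop.
rewrite mulr1 opprD addrA subrr sub0r oppr_eq0 big_seq_cond big1 // => l.
move=> /andP[ltop nlg]; have [El0|El] := eqVneq ((E l)@_g) 0; first by rewrite El0 mulr0.
have [_ _ _ /(_ g El)[egl|/andP[_]]] := ER l ltop.
  by rewrite egl eqxx in nlg.
by move: ltop; rewrite mem_filter => /andP[/eqP -> _]; rewrite cg ltnn.
Qed.
End ElementarySpan.

(** * Quasi-symmetric power series *)

Definition plt : rel posint := fun x y => (x < y)%N.

Lemma plt_trans : transitive plt.
Proof. by move=> y x z; apply: ltn_trans. Qed.

Lemma plt_irr : irreflexive plt.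
Proof. by move=> x; rewrite /plt ltnn. Qed.

Lemma ple_total : total ple.
Proof. by move=> x y; apply: leq_total. Qed.

Lemma ple_anti : antisymmetric ple.
Proof. by move=> x y le; apply/val_inj/eqP; rewrite eqn_leq. Qed.

Lemma plt_sorted_uniq i : sorted plt i -> uniq i.
Proof. by apply: sorted_uniq; [apply: plt_trans | apply: plt_irr]. Qed.

Definition indices (m : mon) : seq posint := sort ple (finsupp m).

Lemma mem_indices (m : mon) i : (i \in indices m) = (m i != 0%N).
Proof. by rewrite mem_sort cmE_neq0. Qed.

Lemma uniq_indices m : uniq (indices m).
Proof. by rewrite sort_uniq fset_uniq. Qed.

Lemma sorted_indices m : sorted plt (indices m).
Proof.
have := sort_sorted ple_total (finsupp m); rewrite -/(indices m).
have := uniq_indices m; case: (indices m) => //= x s.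
elim: s x => //= y s IH x /and3P[nx ny us] /andP[xy sy].
rewrite IH ?ny // andbT /plt ltn_neqAle [(_ <= _)%N]xy andbT val_eqE.
by apply: contraNneq nx => ->; rewrite inE eqxx.
Qed.

Definition exponent (m : mon) (i : posint) : posint := insubd pone (m i).

(** The only composition [a] such that [m] occurs in [M_a]. *)
Definition expseq (m : mon) : compn := map (exponent m) (indices m).

Lemma exponentE (m : mon) i : m i != 0%N -> exponent m i = m i :> nat.
Proof. by rewrite -lt0n /exponent val_insubd => ->. Qed.

Lemma expcmnE (m : mon) n j : (expcmn m n) j = (m j * n)%N.
Proof.
elim: n => [|n IH]; first by rewrite onecmE muln0.
case: n IH => [|n] IH; first by rewrite muln1.
by rewrite -[expcmn m n.+2]/(mulcm m (expcmn m n.+1)) mulcmE IH [RHS]mulnS.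
Qed.

Lemma xpowE i a j : (xpow i a) j = (\sum_(p <- zip i a | p.1 == j) (p.2 : nat))%N.
Proof.
rewrite /xpow; elim: (zip i a) => [|[l x] s IH]; first by rewrite !big_nil onecmE.
rewrite !big_cons mulcmE IH expcmnE ucmE /=.
by case: eqP; rewrite ?mul1n ?mul0n.
Qed.

Lemma xpow_nth i a t : uniq i -> size i = size a -> (t < size i)%N ->
  (xpow i a) (nth pone i t) = nth pone a t.
Proof.
rewrite xpowE; elim: i a t => [|l i IH] [|x a] [|t] //= /andP[li ui] [sz] lt.
  rewrite big_cons eqxx /= big_seq_cond big1 ?addn0 // => -[j y] /andP[].
  move=> /(map_f fst) /=; rewrite -/unzip1 unzip1_zip ?sz // => ji /eqP /= ej.
  by rewrite -ej ji in li.
rewrite big_cons /=; case: eqP => [e|_]; last exact: IH.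
by rewrite e mem_nth in li.
Qed.

Lemma xpow_out i a j : j \notin i -> (xpow i a) j = 0%N.
Proof.
rewrite xpowE => ji; rewrite big_seq_cond big1 // => -[l x] /andP[lx /eqP /= lj].
case/negP: ji; rewrite -lj; elim: i a lx {lj} => [|y i IH] [|z a] //=.
by rewrite !inE => /orP[/eqP[-> _]|/IH ->]; rewrite ?eqxx ?orbT.
Qed.

Lemma xpow_neq0 i a j : uniq i -> size i = size a ->
  ((xpow i a) j != 0%N) = (j \in i).
Proof.
move=> ui sz; case: (boolP (j \in i)) => [ji|ji]; last by rewrite xpow_out.
rewrite -(nth_index pone ji) xpow_nth // ?index_mem //.
by rewrite -lt0n; case: (nth _ _ _).
Qed.

Lemma indices_xpow i a : sorted plt i -> size i = size a -> indices (xpow i a) = i.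
Proof.
move=> si sz; apply: (irr_sorted_eq plt_trans plt_irr) => //.
  exact: sorted_indices.
by move=> j; rewrite mem_indices xpow_neq0 // plt_sorted_uniq.
Qed.

Lemma expseq_xpow i a : sorted plt i -> size i = size a -> expseq (xpow i a) = a.
Proof.
move=> si sz; rewrite /expseq indices_xpow //.
apply: (@eq_from_nth _ pone); rewrite size_map // => t lt.
have ui := plt_sorted_uniq si.
rewrite (nth_map pone) //; apply: val_inj; rewrite /= exponentE ?xpow_nth //.
by rewrite -lt0n; case: (nth _ _ _).
Qed.

Lemma xpow_expseq m : xpow (indices m) (expseq m) = m.
Proof.
apply/eqP/cmP => j; have [mj|mj] := eqVneq (m j) 0%N.
  by rewrite mj xpow_out // mem_indices mj eqxx.
have ji : j \in indices m by rewrite mem_indices.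
rewrite -{1}(nth_index pone ji) xpow_nth ?uniq_indices ?size_map ?index_mem //.
by rewrite (nth_map pone) ?index_mem // nth_index // exponentE.
Qed.

Lemma mdeg_expseq (m : mon) : mdeg m = weight (expseq m).
Proof.
rewrite mdegE /weight big_map (perm_big (indices m)) /=; last by rewrite perm_sym perm_sort.
rewrite big_seq [RHS]big_seq; apply: eq_bigr => i; rewrite mem_indices => mi.
by rewrite exponentE.
Qed.

Lemma expseq_mul (m1 m2 : mon) :
  weight (expseq (mmul m1 m2)) = (weight (expseq m1) + weight (expseq m2))%N.
Proof. by rewrite -!mdeg_expseq mdegM. Qed.

(** The monomial [m] with each variable [i] renamed to [s i]. *)
Definition rename (s : posint -> posint) (m : mon) : mon :=
  xpow (map s (indices m)) (expseq m).

Lemma xpow_map s i a j : injective s -> (xpow (map s i) a) (s j) = (xpow i a) j.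
Proof.
move=> inj; rewrite !xpowE; elim: i a => [|l i IH] [|x a] /=; rewrite ?big_nil //.
by rewrite !big_cons /= IH (inj_eq inj).
Qed.

Lemma renameE s m j : injective s -> (rename s m) (s j) = m j.
Proof. by move=> inj; rewrite xpow_map // xpow_expseq. Qed.

Lemma expseq_relabel (s : posint -> posint) (m m' : mon) : bijective s ->
  (forall i, m' i = m (s i)) -> perm_eq (expseq m') (expseq m).
Proof.
move=> bij mm'; have inj := bij_inj bij.
have -> : expseq m' = map (exponent m) (map s (indices m')).
  by rewrite -map_comp; apply: eq_map => i /=; rewrite /exponent mm'.
apply: perm_map; apply: uniq_perm; rewrite ?map_inj_uniq ?uniq_indices //.
move=> j; case: bij => t st ts; rewrite -[j]ts mem_map // !mem_indices.
by rewrite mm'.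
Qed.

(** By induction: compose a bijection that is right on the tails with the
    transposition that corrects the image of the first index. *)
Lemma relabelling (i j : seq posint) : uniq i -> uniq j -> size i = size j ->
  exists2 s : posint -> posint, bijective s & map s i = j.
Proof.
elim: i j => [|x i IH] [|y j] //=; first by exists id => //; exists id.
move=> /andP[xi ui] /andP[yj uj] [sz]; have [s bs si] := IH j ui uj sz.
pose t z := if z == s x then y else if z == y then s x else z.
have tK : involutive t.
  move=> z; rewrite /t; have [->|zx] := eqVneq z (s x).
    by rewrite eqxx; case: eqVneq => // ->.
  have [->|zy] := eqVneq z y; first by rewrite eqxx.
  by rewrite (negPf zx) (negPf zy).
exists (t \o s); first by apply: bij_comp bs; exists t.
rewrite /= {1}/t eqxx map_comp si; congr cons; rewrite -[RHS]map_id.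
apply/eq_in_map => z zj; rewrite /t; have [ez|_] := eqVneq z (s x).
  by move: zj; rewrite ez -si mem_map ?(negPf xi) //; apply: bij_inj.
by case: eqVneq => // ez; rewrite ez (negPf yj) in zj.
Qed.

Section Series.
Variable k : fieldType.

Lemma MseriesE a m : Mseries k a m = (a == expseq m)%:R.
Proof.
rewrite /Mseries; set A := [set i | _].
have F0 i : A i -> i != indices m -> ((xpow i a == m)%:R : k) = 0.
  move=> [si sz] ni; case: eqP => // e.
  by rewrite -e indices_xpow ?eqxx // in ni.
case: (eqVneq a (expseq m)) => [ea|na].
  have Am : A (indices m) by split; [apply: sorted_indices | rewrite ea size_map].
  rewrite (fsbigE [:: indices m]) //=.
  - by rewrite big_cons big_nil mem_set // ea xpow_expseq eqxx addr0.
  - by move=> i /=; rewrite inE => /eqP ->.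
  - by move=> i Ai; rewrite inE => /(F0 i Ai).
rewrite fsbig1 // => i [si sz]; case: eqP => // e.
by rewrite -e expseq_xpow ?eqxx // in na.
Qed.

Lemma seriesE (f : {malg k[compn]}) m : series f m = f@_(expseq m).
Proof.
rewrite /series; under eq_bigr do rewrite MseriesE.
have [fm|fm] := boolP (expseq m \in msupp f).
  rewrite (bigD1_seq (expseq m)) ?fset_uniq //= eqxx mulr1 big1 ?addr0 // => a.
  by move=> /negPf ->; rewrite mulr0.
rewrite (mcoeff_outdom fm) big_seq big1 // => a fa.
by case: eqP => [ea|_]; rewrite ?mulr0 //; rewrite -ea fa in fm.
Qed.

(** Hence a symmetric power series is determined by its coefficients at the
    monomials [mono a] in the first variables. *)
Lemma psymmetric_expseq (F : pseries k) (m m' : mon) : psymmetric F ->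
  expseq m = expseq m' -> F m = F m'.
Proof.
move=> symF e; have [|s bs es] := relabelling (uniq_indices m) (uniq_indices m').
  by rewrite -(size_map (exponent m)) -/(expseq m) e size_map.
symmetry; case: (bs) => t st ts; apply: (symF t); first by exists s.
move=> i; rewrite -{1}[i]ts -[in LHS](xpow_expseq m') -es -e xpow_map ?xpow_expseq //.
exact: bij_inj.
Qed.

Definition posints n : seq posint := [seq PosInt (ltn0Sn t) | t <- iota 0 n].

Lemma sorted_posints n : sorted plt (posints n).
Proof. by rewrite sorted_map; apply: iota_ltn_sorted. Qed.

Lemma size_posints n : size (posints n) = n.
Proof. by rewrite size_map size_iota. Qed.

Definition mono (a : compn) : mon := xpow (posints (size a)) a.

Lemma expseq_mono a : expseq (mono a) = a.
Proof. by apply: expseq_xpow; rewrite ?sorted_posints ?size_posints. Qed.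

Lemma SymE : @Sym k = @csymset k.
Proof.
apply/seteqP; split=> f /= symf; last first.
  move=> s bs m m' mm'; rewrite !seriesE; apply: symf; exact: expseq_relabel mm'.
apply: adjacent_swaps_perm => a x y b.
rewrite -[a ++ x :: _]expseq_mono -[a ++ y :: _]expseq_mono /coef -!seriesE.
have ez : size (a ++ y :: x :: b) = size (a ++ x :: y :: b) by rewrite !size_cat.
rewrite {2}/mono ez; set i := posints _.
have zi : size i = (size a + (size b).+2)%N by rewrite size_posints size_cat.
have ui : uniq i by apply/plt_sorted_uniq/sorted_posints.
have [i1 [u [v [i2 [ei z1]]]]] : exists i1 u v i2, i = i1 ++ u :: v :: i2 /\ size i1 = size a.
  have := cat_take_drop (size a) i; have : size (drop (size a) i) = (size b).+2.
    by rewrite size_drop zi addKn.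
  case: (drop _ i) => [|u [|v i2]] // _ <-.
  by exists (take (size a) i), u, v, i2; rewrite size_takel // zi leq_addr.
have [||s bs es] := @relabelling i (i1 ++ v :: u :: i2) ui.
- move: ui; rewrite ei !(perm_uniq (_ : perm_eq (i1 ++ v :: u :: i2) (i1 ++ u :: v :: i2))) //.
  by rewrite perm_cat2l (perm_catCA [:: v] [:: u]).
- by rewrite ei !size_cat.
have -> : xpow i (a ++ y :: x :: b) = rename s (mono (a ++ x :: y :: b)).
  rewrite /rename expseq_mono indices_xpow ?sorted_posints ?size_posints // -/i es ei.
  rewrite /xpow !zip_cat // !big_cat /= !big_cons; congr mmul.
  by rewrite !mulmA; congr mmul; rewrite mulmC.
case: (bs) => t st ts; symmetry; apply: (symf t); first by exists s.
by move=> j; rewrite -{1}[j]ts renameE //; apply: bij_inj.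
Qed.

Definition trunc N (G : compn -> k) : {malg k[compn]} :=
  [malg a in [fset a in flatten [seq comps n | n <- iota 0 N]]%fset => G a].

Lemma mcoeff_trunc N G a : (trunc N G)@_a = if (weight a < N)%N then G a else 0.
Proof.
rewrite mcoeffE in_fset /=; congr (if _ then _ else _); apply/flatten_mapP/idP.
  by case=> n; rewrite mem_iota add0n mem_comps => /andP[_ lt] /eqP ->.
by move=> lt; exists (weight a); rewrite ?mem_iota ?mem_comps.
Qed.

Lemma csym_trunc N G : csym G -> csymset (trunc N G).
Proof.
by move=> symG a b ab; rewrite /coef !mcoeff_trunc (weight_perm ab) (symG a b ab).
Qed.

Lemma bounded_weight (f : {malg k[compn]}) :
  exists N, forall a, f@_a != 0 -> (weight a < N)%N.
Proof.
exists (\sum_(a <- msupp f) weight a).+1%N => a; rewrite mcoeff_neq0 ltnS => fa.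
by rewrite (bigD1_seq a) ?fset_uniq //= leq_addr.
Qed.

(** Renaming the variables permutes the factorizations of monomials. *)
Lemma pmul_symmetric (F G : pseries k) : psymmetric F -> psymmetric G ->
  psymmetric (pmul F G).
Proof.
move=> symF symG s [t st ts] m m' mm'.
have inj_t := can_inj ts.
have renI u v (p : mon) : cancel u v -> cancel v u -> rename u (rename v p) = p.
  move=> uv vu; have [iu iv] := (can_inj uv, can_inj vu).
  by apply/eqP/cmP => i; rewrite -[in LHS](vu i) !renameE.
have renM (p q : mon) : mmul (rename t p) (rename t q) = rename t (mmul p q).
  by apply/eqP/cmP => i; rewrite -(st i) !mulcmE !renameE // mulcmE.
have ren_m : rename t m = m'.
  by apply/eqP/cmP => i; rewrite -[in LHS](st i) renameE.
have symt H (p : mon) : psymmetric H -> H (rename t p) = H p :> k.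
  move=> symH; apply: (symH s); first by exists t.
  by move=> i; rewrite -[in LHS](st i) renameE.
pose h (p : mon * mon) := (rename t p.1, rename t p.2).
rewrite /pmul (reindex_fsbig h [set p | mmul p.1 p.2 = m]).
  by apply: eq_fsbigr => p _; rewrite !symt.
split=> [p /= em|[p1 p2] [q1 q2] _ _ [e1 e2]|[p1 p2] /= em'].
- by rewrite renM em ren_m.
- by rewrite -(renI s t p1) // -(renI s t p2) // e1 e2 !renI.
exists (rename s p1, rename s p2) => /=; last by rewrite /h /= !renI.
by rewrite -(renI s t (mmul _ _)) // -renM !renI // em' -ren_m renI.
Qed.

Lemma Sym_mul f g : Sym f -> Sym g ->
  exists2 h : {malg k[compn]}, Sym h & series h = pmul (series f) (series g).
Proof.
move=> symf symg; set F := pmul _ _.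
have symF : psymmetric F by apply: pmul_symmetric.
have [Nf fN] := bounded_weight f; have [Ng gN] := bounded_weight g.
have F0 m : (Nf + Ng <= weight (expseq m))%N -> F m = 0.
  move=> lem; rewrite /F /pmul fsbig1 // => -[p q] /= em; rewrite !seriesE.
  apply/eqP; rewrite mulf_eq0; apply: contraLR lem; rewrite negb_or -em expseq_mul.
  by move=> /andP[/fN lt1 /gN lt2]; lia.
have eF (m : mon) : series (trunc (Nf + Ng) (fun a => F (mono a))) m = F m.
  rewrite seriesE mcoeff_trunc; case: ltnP => [_|/F0 -> //].
  by apply: psymmetric_expseq => //; rewrite expseq_mono.
exists (trunc (Nf + Ng) (fun a => F (mono a))); last exact/funext.
by move=> s bs m m' mm'; rewrite !eF; apply: symF mm'.
Qed.

Lemma mcoeff_tensor (B C : choiceType) (x : {malg k[B]}) (y : {malg k[C]}) b c :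
  (tensor x y)@_(b, c) = x@_b * y@_c.
Proof.
rewrite /tensor raddf_sum /=.
under eq_bigr do rewrite raddf_sum /=.
under eq_bigr do under eq_bigr do rewrite mcoeffZ mcoeffU xpair_eqE.
have [bx|bx] := boolP (b \in msupp x); last first.
  rewrite (mcoeff_outdom bx) mul0r big_seq big1 // => b' b'x.
  rewrite big1 // => c' _; case: eqP => [e|]; last by rewrite mulr0.
  by rewrite -e b'x in bx.
rewrite (bigD1_seq b) ?fset_uniq //= [X in _ + X]big1 ?addr0; last first.
  by move=> b' /negPf->; rewrite big1 // => c' _; rewrite mulr0.
have [cy|cy] := boolP (c \in msupp y); last first.
  rewrite (mcoeff_outdom cy) mulr0 big_seq big1 // => c' c'y.
  by rewrite eqxx; case: eqP => [e|]; rewrite ?mulr0 //; rewrite -e c'y in cy.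
rewrite (bigD1_seq c) ?fset_uniq //= !eqxx mulr1 big1 ?addr0 // => c' /negPf->.
by rewrite mulr0.
Qed.

Lemma mcoeff_Delta (f : {malg k[compn]}) b c : (Delta f)@_(b, c) = f@_(b ++ c).
Proof.
rewrite /Delta /linext raddf_sum /=.
have cut a : (\sum_(j < (size a).+1) (<< (take j a, drop j a) >> :
    {malg k[(compn * compn)%type]}))@_(b, c) = (a == b ++ c)%:R.
  rewrite raddf_sum /=; under eq_bigr do rewrite mcoeffU xpair_eqE.
  case: eqP => [->|ne]; last first.
    rewrite big1 // => j _; case: andP => // -[/eqP eb /eqP ec].
    by case: ne; rewrite -eb -ec cat_take_drop.
  have lt : (size b < (size (b ++ c)).+1)%N by rewrite ltnS size_cat leq_addr.
  rewrite (bigD1 (Ordinal lt)) //= take_size_cat // drop_size_cat // !eqxx.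
  rewrite big1 ?addr0 // => j nj; case: andP => // -[/eqP eb _]; case/eqP: nj.
  apply: val_inj => /=; have := congr1 size eb; rewrite size_takel //.
  by rewrite -ltnS.
under eq_bigr do rewrite mcoeffZ cut.
have [fm|fm] := boolP (b ++ c \in msupp f).
  rewrite (bigD1_seq (b ++ c)) ?fset_uniq //= eqxx mulr1 big1 ?addr0 // => a.
  by move=> /negPf ->; rewrite mulr0.
rewrite (mcoeff_outdom fm) big_seq big1 // => a fa.
by case: eqP => [ea|_]; rewrite ?mulr0 //; rewrite -ea fa in fm.
Qed.

(** Grouping the second factors by their sorted rearrangement [nu], the part of
    [Delta f] belonging to [nu] is a pure tensor. *)
Lemma Sym_Delta (f : {malg k[compn]}) : Sym f ->
  Defs.span [set t | exists f1 f2 : {malg k[compn]},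
    [/\ Sym f1, Sym f2 & t = tensor f1 f2]] (Delta f).
Proof.
rewrite !SymE => symf; have [N fN] := bounded_weight f.
pose D := flatten [seq comps n | n <- iota 0 N].
pose V := undup (map (sort ple) D).
pose left_part nu := trunc N (fun b => f@_(b ++ nu)).
pose right_part nu := trunc N (fun c => (sort ple c == nu)%:R).
have -> : Delta f = \sum_(nu <- V) tensor (left_part nu) (right_part nu).
  apply/malgP => -[b c]; rewrite mcoeff_Delta raddf_sum /=.
  under eq_bigr do rewrite mcoeff_tensor !mcoeff_trunc.
  have bound : f@_(b ++ c) != 0 -> (weight b < N)%N && (weight c < N)%N.
    by move=> /fN; rewrite weight_cat; lia.
  have [cV|cV] := boolP (sort ple c \in V); last first.
    have wc : (weight c < N)%N = false.
      apply: contraNF cV => wc; rewrite mem_undup; apply/map_f/flatten_mapP.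
      by exists (weight c); rewrite ?mem_iota ?mem_comps.
    rewrite big1 => [|nu _]; last by rewrite wc mulr0.
    by apply/eqP; apply: contraFT wc => /bound/andP[].
  rewrite (bigD1_seq (sort ple c)) ?undup_uniq //= eqxx big1 ?addr0; last first.
    by move=> nu; rewrite eq_sym => /negPf->; rewrite if_same mulr0.
  have -> : f@_(b ++ sort ple c) = f@_(b ++ c).
    by apply: symf; rewrite perm_cat2l perm_sort.
  have [->|/bound/andP[-> ->]] := eqVneq (f@_(b ++ c)) 0; last by rewrite mulr1.
  by rewrite if_same mul0r.
apply: lin_closed_sum; first exact: span_lin_closed.
move=> nu _; apply: subset_span; exists (left_part nu), (right_part nu); split=> //.
  apply: csym_trunc => a b ab; apply: symf; by rewrite perm_cat2r.
apply: csym_trunc => a b ab; congr (_ == _)%:R.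
by apply/perm_sortP => //; [apply: ple_total | apply: ple_trans | apply: ple_anti].
Qed.

Lemma Sym_sub_bialgebra : sub_bialgebra_of_Sym (@Sym k).
Proof.
split=> //.
- by rewrite SymE; case: (csymset_lin_closed k).
- by rewrite SymE; case: (csymset_lin_closed k).
- rewrite SymE => a b ab; rewrite /coef !mcoeffU; congr (_ *+ (nat_of_bool _)).
  apply/eqP/eqP => e; move: ab; rewrite -e; last by move/perm_nilP.
  by rewrite perm_sym => /perm_nilP.
- exact: Sym_mul.
- exact: Sym_Delta.
Qed.
End Series.

(** * The equivalence *)

Section Image.
Variables (k : fieldType) (sim : word -> word -> Prop).
Hypotheses (sim_wrel : word_relation sim) (sim_hom : homogeneous sim).
Hypothesis sim_ualg : uniformly_algebraic sim.

Lemma csym_sub_image_gt : @csymset k `<=` psi_gt k @` Kspace k sim.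
Proof.
move=> f symf; have [N fN] := bounded_weight f.
have linA : lin_closed (psi_gt k @` Kspace k sim).
  exact: (lin_closed_image (psi_gt k) (Kspace_lin_closed k sim)).
apply: (csym_sub_span linA _ symf (B := N) (n := (N ^ N)%N)) => [u|g /fN wg].
  exists (psi_gt k (\sum_(w <- permutations u) << wp (maxw u) w >>)).
    by apply: imageP; apply: Kspace_content.
  by move=> g; rewrite coef_psi_gt_content.
by rewrite wg code_bound ?parts_lt //; case: (N) wg.
Qed.

(** [f] is [psi_gt x], that is the image of [psi_le x] under the involution.  As
    [psi_le x] is symmetric too, it is [psi_gt y] for some [y], and applying the
    involution again gives [f = psi_le y]. *)
Lemma csym_sub_image_le : @csymset k `<=` psi_le k @` Kspace k sim.
Proof.
have gt_le x : csymset (psi_gt k x) -> csymset (psi_le k x) by apply: csym_psi_le.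
move=> f symf; have [x Kx fx] := csym_sub_image_gt symf.
have [|y Ky xy] := csym_sub_image_gt (_ : csymset (psi_le k x)).
  by apply: gt_le; rewrite fx.
exists y => //; apply/malgP => g.
by rewrite psi_le_omega xy -psi_gt_omega fx.
Qed.

Lemma image_le_gt : psi_le k @` Kspace k sim `<=` @csymset k <->
  psi_gt k @` Kspace k sim `<=` @csymset k.
Proof.
split=> sub _ [x Kx <-].
  by apply: csym_psi_gt; apply: sub; apply: imageP.
by apply: csym_psi_le; apply: sub; apply: imageP.
Qed.

Lemma sub_bialgebra_subset (A : set {malg k[compn]}) : @csymset k `<=` A ->
  sub_bialgebra_of_Sym A <-> A `<=` @csymset k.
Proof.
move=> symA; split=> [[]|subA]; first by rewrite SymE.
have -> : A = @csymset k by apply/seteqP; split.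
by rewrite -SymE; apply: Sym_sub_bialgebra.
Qed.

End Image.

Theorem corollary8p15 (k : fieldType) (char0 : [pchar k] =i pred0)
    (sim : seq posint -> seq posint -> Prop)
    (sim_wrel : word_relation sim)
    (sim_hom : homogeneous sim)
    (sim_ualg : uniformly_algebraic sim) :
  [<-> sub_bialgebra_of_Sym (psi_le k @` Kspace k sim);
       sub_bialgebra_of_Sym (psi_gt k @` Kspace k sim);
       extends sim knuth].
Proof.
have suble := @csym_sub_image_le k _ sim_wrel sim_hom sim_ualg.
have subgt := @csym_sub_image_gt k _ sim_wrel sim_hom sim_ualg.
tfae.
- move=> /(sub_bialgebra_subset suble)/image_le_gt.
  by move/(sub_bialgebra_subset subgt).
- move=> /(sub_bialgebra_subset subgt)/image_le_gt.
  exact: knuth_of_csym.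
- move=> ext; apply/(sub_bialgebra_subset suble).
  exact: csym_of_knuth.
Qed.
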